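(* Let $H$ be a bialgebra over a field $K$, let $A$ be an $H$-comodule-algebra with structure map $\rho$, and let $R_t=\sum_{i=0}^\infty\rho_it^i$ be a deformation of $A$ as an $H$-comodule-algebra. Then the infinitesimal $\rho_1$ is a $1$-cocycle in $\mathcal{F}^1_{ca}(A)$ whose cohomology class in $H^1(\mathcal{F}^\bullet_{ca}(A))$ is determined by the equivalence class of $R_t$ (equivalent deformations have cohomologous infinitesimals). Moreover: (1) If $H^2_h(A,A)$ and $H^1(\mathcal{F}^\bullet_{ca}(A))$ are both trivial, then $A$ is rigid, i.e. every deformation of $A$ is equivalent to the trivial deformation $R_t=\rho$. (2) If $H^2(\mathcal{F}^\bullet_{ca}(A))$ is trivial, then every $1$-cocycle in $\mathcal{F}^1_{ca}(A)$ is the infinitesimal of some deformation of $A$.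
   Context: Fix a field $K$; $\otimes$ and $\mathrm{Hom}$ are over $K$. $(H,\mu_H,\Delta_H)$ is a $K$-bialgebra and $(A,\mu_A)$ an associative algebra. $\tau:A\otimes H\to H\otimes A$ is the twist $a\otimes x\mapsto x\otimes a$. An $H$-comodule-algebra structure on $A$ is an $H$-comodule structure $\rho:A\to H\otimes A$ such that $$\rho\circ\mu_A=(\mu_H\otimes\mu_A)\circ(\mathrm{Id}_H\otimes\tau\otimes\mathrm{Id}_A)\circ\rho^{\otimes2}.$$ A deformation of $A$ is a power series $R_t=\sum_{i\ge0}\rho_it^i$ with $\rho_0=\rho$, each $\rho_i\in\mathrm{Hom}(A,H\otimes A)$, satisfying (maps extended linearly to power series) $$(\mathrm{Id}_H\otimes R_t)\circ R_t=(\Delta_H\otimes\mathrm{Id}_A)\circ R_t,\qquad R_t\circ\mu_A=(\mu_H\otimes\mu_A)\circ(\mathrm{Id}_H\otimes\tau\otimes\mathrm{Id}_A)\circ R_t^{\otimes2}.$$ Its infinitesimal is $\rho_1$. A formal automorphism of $A$ is a power series $\Phi_t=\sum_{i\ge0}\phi_it^i$ with $\phi_0=\mathrm{Id}_A$, each $\phi_i$ a linear endomorphism of $A$, and $\Phi_t(ab)=\Phi_t(a)\Phi_t(b)$ for all $a,b\in A$. Deformations $R_t,\overline{R}_t$ are equivalent if $\overline{R}_t=(\mathrm{Id}_H\otimes\Phi_t^{-1})\circ R_t\circ\Phi_t$ for some formal automorphism $\Phi_t$. Cochain complex $\mathcal{F}^\bullet_{ca}(A)$: $\mathcal{F}^0_{ca}(A)=\mathrm{Der}(A)$,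 the space of derivations of $A$; $\mathcal{F}^1_{ca}(A)=\mathrm{Hom}(A,H\otimes A)$; for $n\ge2$, $\mathcal{F}^n_{ca}(A)=\mathrm{Hom}(A,H^{\otimes n}\otimes A)\oplus\mathrm{Hom}(A^{\otimes n},H\otimes A)$. Differentials: $d^0_{ca}\phi=\rho\circ\phi-(\mathrm{Id}_H\otimes\phi)\circ\rho$; for $n\ge1$, $d^n_{ca}(\varphi_0;\varphi_1)=(d^n_{ca,0}\varphi_0;d^n_{ca,1}\varphi_1)$ (for $n=1$, $\varphi_0=\varphi_1=\varphi$), where $$d^n_{ca,0}\varphi_0=(\mathrm{Id}_{H^{\otimes n}}\otimes\rho)\circ\varphi_0+\sum_{i=1}^n(-1)^i(\mathrm{Id}_{H^{\otimes(n-i)}}\otimes\Delta_H\otimes\mathrm{Id}_{H^{\otimes(i-1)}\otimes A})\circ\varphi_0+(-1)^{n+1}(\mathrm{Id}_H\otimes\varphi_0)\circ\rho,$$ $$d^n_{ca,1}\varphi_1=(\mu_H\otimes\mu_A)\circ(\mathrm{Id}_H\otimes\tau\otimes\mathrm{Id}_A)\circ(\rho\otimes\varphi_1)+\sum_{i=1}^n(-1)^i\varphi_1\circ(\mathrm{Id}_{A^{\otimes(i-1)}}\otimes\mu_A\otimes\mathrm{Id}_{A^{\otimes(n-i)}})+(-1)^{n+1}(\mu_H\otimes\mu_A)\circ(\mathrm{Id}_H\otimes\tau\otimes\mathrm{Id}_A)\circ(\varphi_1\otimes\rho).$$ $H^\bullet_h(A,A)$ is the Hochschild cohomology of the associative algebra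 $A$ with coefficients in itself, computed by the complex $C^n_h(A,A)=\mathrm{Hom}(A^{\otimes n},A)$, $n\ge0$, with the usual Hochschild coboundary. *)

(* Defs.v *)
From HB Require Import structures.
From mathcomp Require Import all_boot all_algebra.
From mathcomp Require Import boolp.

Set Implicit Arguments.
Unset Strict Implicit.
Unset Printing Implicit Defensive.

Import GRing.Theory.
Local Open Scope ring_scope.
Local Open Scope quotient_scope.

(** * Spaces of linear maps *)

Lemma linear_ext (K : fieldType) (V W : lmodType K) (f g : {linear V -> W}) :
  f =1 g -> f = g.
Proof.
case: f => f [[f1] [f2]]; case: g => g [[g1] [g2]] /= /funext e.
case: _ / e g1 g2 => g1 g2.
by rewrite (Prop_irrelevance f1 g1) (Prop_irrelevance f2 g2).
Qed.

Section Hom.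
Variables (K : fieldType) (V W : lmodType K).
Implicit Types f g h : {linear V -> W}.

HB.instance Definition _ := gen_eqMixin {linear V -> W}.
HB.instance Definition _ := gen_choiceMixin {linear V -> W}.

Definition hom0 : {linear V -> W} := \0.
Definition homD f g : {linear V -> W} := f \+ g.
Definition homN f : {linear V -> W} := \- f.
Definition homZ (a : K) f : {linear V -> W} := a \*: f.

Fact homDA : associative homD.
Proof. by move=> f g h; apply: linear_ext => x /=; rewrite addrA. Qed.
Fact homDC : commutative homD.
Proof. by move=> f g; apply: linear_ext => x /=; rewrite addrC. Qed.
Fact hom0D : left_id hom0 homD.
Proof. by move=> f; apply: linear_ext => x /=; rewrite add0r. Qed.
Fact homND : left_inverse hom0 homN homD.
Proof. by move=> f; apply: linear_ext => x /=; rewrite addNr. Qed.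
HB.instance Definition _ :=
  GRing.isZmodule.Build {linear V -> W} homDA homDC hom0D homND.

Fact homZA a b f : homZ a (homZ b f) = homZ (a * b) f.
Proof. by apply: linear_ext => x /=; rewrite scalerA. Qed.
Fact homZ1 : left_id 1 homZ.
Proof. by move=> f; apply: linear_ext => x /=; rewrite scale1r. Qed.
Fact homZDr : right_distributive homZ +%R.
Proof. by move=> a f g; apply: linear_ext => x /=; rewrite scalerDr. Qed.
Fact homZDl f : {morph homZ^~ f : a b / a + b}.
Proof. by move=> a b; apply: linear_ext => x /=; rewrite scalerDl. Qed.
HB.instance Definition _ :=
  GRing.Zmodule_isLmodule.Build K {linear V -> W} homZA homZ1 homZDr homZDl.

Lemma hom0E x : (0 : {linear V -> W}) x = 0. Proof. by []. Qed.
Lemma homDE f g x : (f + g) x = f x + g x. Proof. by []. Qed.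
Lemma homNE f x : (- f) x = - f x. Proof. by []. Qed.
Lemma homZE a f x : (a *: f) x = a *: f x. Proof. by []. Qed.
Lemma hom_sumE (I : Type) (r : seq I) (P : pred I) (F : I -> {linear V -> W}) x :
  (\sum_(i <- r | P i) F i) x = \sum_(i <- r | P i) F i x.
Proof. by elim/big_rec2: _ => [|i y f _ <-]. Qed.

End Hom.

Definition lid (K : fieldType) (V : lmodType K) : {linear V -> V} := idfun.
Arguments lid {K} V.

Definition lcomp (K : fieldType) (U V W : lmodType K)
  (f : {linear V -> W}) (g : {linear U -> V}) : {linear U -> W} := f \o g.
Notation "f \oL g" := (lcomp f g) (at level 40, left associativity).

Lemma lidE (K : fieldType) (V : lmodType K) (x : V) : lid V x = x.
Proof. by []. Qed.
Lemma lcompE (K : fieldType) (U V W : lmodType K)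
  (f : {linear V -> W}) (g : {linear U -> V}) x : (f \oL g) x = f (g x).
Proof. by []. Qed.

(** * Tensor products

    [V ⊗ W] is the quotient of the formal sums of [a (v, w)] identifying two
    sums when every bilinear map takes the same value on both; the universal
    property is [tlift_pure] together with [tens_ext]. *)

Definition bilin (K : fieldType) (V W U : lmodType K) (f : V -> W -> U) : Prop :=
  (forall w, linear (f^~ w)) /\ (forall v, linear (f v)).

Section Tensor.
Variables (K : fieldType) (V W : lmodType K).

Definition fsum := seq (K * V * W).

Definition fsum_eval (U : lmodType K) (f : V -> W -> U) (s : fsum) : U :=
  \sum_(p <- s) p.1.1 *: f p.1.2 p.2.

Definition fsum_scale (a : K) (s : fsum) : fsum :=
  [seq (a * p.1.1, p.1.2, p.2) | p <- s].

Lemma fsum_eval_cat (U : lmodType K) (f : V -> W -> U) s t :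
  fsum_eval f (s ++ t) = fsum_eval f s + fsum_eval f t.
Proof. by rewrite /fsum_eval big_cat. Qed.

Lemma fsum_eval_scale (U : lmodType K) (f : V -> W -> U) a s :
  fsum_eval f (fsum_scale a s) = a *: fsum_eval f s.
Proof.
rewrite /fsum_eval big_map scaler_sumr.
by apply: eq_bigr => p _ /=; rewrite scalerA.
Qed.

Definition fsum_eqv (s t : fsum) : bool :=
  `[< forall (U : lmodType K) (f : V -> W -> U),
        bilin f -> fsum_eval f s = fsum_eval f t >].

Fact fsum_eqv_refl : reflexive fsum_eqv.
Proof. by move=> s; apply/asboolP. Qed.
Fact fsum_eqv_sym : symmetric fsum_eqv.
Proof.
by move=> s t; apply/asboolP/asboolP => e U f bf; rewrite e.
Qed.
Fact fsum_eqv_trans : transitive fsum_eqv.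
Proof.
move=> t s u /asboolP e /asboolP e'; apply/asboolP => U f bf.
by rewrite e // e'.
Qed.
Canonical fsum_equiv := EquivRel fsum_eqv
  fsum_eqv_refl fsum_eqv_sym fsum_eqv_trans.

Definition tens := {eq_quot fsum_equiv}.
HB.instance Definition _ := Choice.on tens.

Let cls (s : fsum) : tens := \pi_({eq_quot fsum_equiv}) s.

Let clsP s t : cls s = cls t <->
  forall (U : lmodType K) (f : V -> W -> U),
    bilin f -> fsum_eval f s = fsum_eval f t.
Proof.
split=> [/eqmodP/asboolP //|e]; apply/eqmodP; exact/asboolP.
Qed.

Let clsK (x : tens) : cls (repr x) = x.
Proof. exact: reprK. Qed.

Let eval_repr_cls (U : lmodType K) (f : V -> W -> U) s :
  bilin f -> fsum_eval f (repr (cls s)) = fsum_eval f s.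
Proof. by move=> bf; have /clsP -> := clsK (cls s). Qed.

Let tens_inj (x y : tens) :
  (forall (U : lmodType K) (f : V -> W -> U),
    bilin f -> fsum_eval f (repr x) = fsum_eval f (repr y)) -> x = y.
Proof. by rewrite -{2}(clsK x) -{2}(clsK y) => /clsP. Qed.

Definition tens0 : tens := cls [::].
Definition tensD (x y : tens) : tens := cls (repr x ++ repr y).
Definition tensZ (a : K) (x : tens) : tens := cls (fsum_scale a (repr x)).
Definition tensN (x : tens) : tens := tensZ (-1) x.

Let eval0 (U : lmodType K) (f : V -> W -> U) : bilin f -> fsum_eval f (repr tens0) = 0.
Proof. by move=> bf; rewrite eval_repr_cls // /fsum_eval big_nil. Qed.
Let evalD (U : lmodType K) (f : V -> W -> U) x y : bilin f ->
  fsum_eval f (repr (tensD x y)) = fsum_eval f (repr x) + fsum_eval f (repr y).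
Proof. by move=> bf; rewrite eval_repr_cls // fsum_eval_cat. Qed.
Let evalZ (U : lmodType K) (f : V -> W -> U) a x : bilin f ->
  fsum_eval f (repr (tensZ a x)) = a *: fsum_eval f (repr x).
Proof. by move=> bf; rewrite eval_repr_cls // fsum_eval_scale. Qed.

Fact tensDA : associative tensD.
Proof. by move=> x y z; apply: tens_inj => U f bf; rewrite !evalD // addrA. Qed.
Fact tensDC : commutative tensD.
Proof. by move=> x y; apply: tens_inj => U f bf; rewrite !evalD // addrC. Qed.
Fact tens0D : left_id tens0 tensD.
Proof.
by move=> x; apply: tens_inj => U f bf; rewrite !evalD // eval0 // add0r.
Qed.
Fact tensND : left_inverse tens0 tensN tensD.
Proof.
move=> x; apply: tens_inj => U f bf.
by rewrite evalD // evalZ // eval0 // scaleN1r addNr.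
Qed.
HB.instance Definition _ :=
  GRing.isZmodule.Build tens tensDA tensDC tens0D tensND.

Fact tensZA a b x : tensZ a (tensZ b x) = tensZ (a * b) x.
Proof. by apply: tens_inj => U f bf; rewrite !evalZ // scalerA. Qed.
Fact tensZ1 : left_id 1 tensZ.
Proof. by move=> x; apply: tens_inj => U f bf; rewrite evalZ // scale1r. Qed.
Fact tensZDr : right_distributive tensZ +%R.
Proof.
move=> a x y; apply: tens_inj => U f bf.
by rewrite !(evalZ, evalD) // scalerDr.
Qed.
Fact tensZDl x : {morph tensZ^~ x : a b / a + b}.
Proof.
move=> a b; apply: tens_inj => U f bf.
by rewrite !(evalZ, evalD) // scalerDl.
Qed.
HB.instance Definition _ :=
  GRing.Zmodule_isLmodule.Build K tens tensZA tensZ1 tensZDr tensZDl.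

Definition pure (v : V) (w : W) : tens := cls [:: (1, v, w)].

Let eval_pure (U : lmodType K) (f : V -> W -> U) v w : bilin f ->
  fsum_eval f (repr (pure v w)) = f v w.
Proof.
by move=> bf; rewrite eval_repr_cls // /fsum_eval big_seq1 scale1r.
Qed.

Lemma pure_bilin : bilin pure.
Proof.
split=> [w a v v'|v a w w']; apply: tens_inj => U f bf;
  rewrite evalD // evalZ // !eval_pure //; case: bf => bl br.
  exact: bl.
exact: br.
Qed.

Lemma tens_span (x : tens) :
  exists s : seq (V * W), x = \sum_(p <- s) pure p.1 p.2.
Proof.
exists [seq (p.1.1 *: p.1.2, p.2) | p <- repr x].
have evalS (U : lmodType K) (f : V -> W -> U) (s : seq (V * W)) : bilin f ->
  fsum_eval f (repr (\sum_(p <- s) pure p.1 p.2)) = \sum_(p <- s) f p.1 p.2.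
  move=> bf; elim: s => [|p s IH]; first by rewrite !big_nil eval0.
  by rewrite !big_cons evalD // IH eval_pure.
apply: tens_inj => U f bf; rewrite evalS // big_map.
rewrite /fsum_eval; apply: eq_bigr => p _ /=; case: bf => bl _.
have b0 : f 0 p.2 = 0 by have := bl p.2 (-1) 0 0; rewrite scaler0 addr0 scaleN1r addNr.
by have := bl p.2 p.1.1 p.1.2 0; rewrite !addr0 b0 addr0.
Qed.

Section Lift.
Variables (U : lmodType K) (f : V -> W -> U) (bf : bilin f).

Definition tlift_fun of bilin f := fun x : tens => fsum_eval f (repr x).

Fact tlift_linear : linear (tlift_fun bf).
Proof. by move=> a x y; rewrite /tlift_fun evalD // evalZ. Qed.
HB.instance Definition _ :=
  GRing.isLinear.Build K tens U *:%R (tlift_fun bf) tlift_linear.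

(* locked, so that [/=] does not unfold maps out of tensor products *)
Fact tlift_key : unit. Proof. by []. Qed.
Definition tlift : {linear tens -> U} :=
  locked_with tlift_key (tlift_fun bf : {linear tens -> U}).

Lemma tlift_pure v w : tlift (pure v w) = f v w.
Proof. by rewrite /tlift locked_withE; exact: eval_pure. Qed.

End Lift.

Lemma tens_ext (U : lmodType K) (g h : {linear tens -> U}) :
  (forall v w, g (pure v w) = h (pure v w)) -> g = h.
Proof.
move=> e; apply: linear_ext => x; have [s ->] := tens_span x.
by rewrite !raddf_sum; apply: eq_bigr => p _; exact: e.
Qed.

End Tensor.

Notation "V ⊗ W" := (tens V W) (at level 39, left associativity) : type_scope.
Notation "v ⊗p w" := (pure v w) (at level 39, left associativity) : ring_scope.

Section PureTheory.
Variable K : fieldType.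
Implicit Types U V W : lmodType K.

Lemma pureDl V W (v v' : V) (w : W) : (v + v') ⊗p w = v ⊗p w + v' ⊗p w.
Proof. by have := (pure_bilin V W).1 w 1 v v'; rewrite !scale1r. Qed.
Lemma pureDr V W (v : V) (w w' : W) : v ⊗p (w + w') = v ⊗p w + v ⊗p w'.
Proof. by have := (pure_bilin V W).2 v 1 w w'; rewrite !scale1r. Qed.
Lemma pure0l V W (w : W) : (0 : V) ⊗p w = 0.
Proof. by apply: (addIr ((0 : V) ⊗p w)); rewrite -pureDl !add0r. Qed.
Lemma pure0r V W (v : V) : v ⊗p (0 : W) = 0.
Proof. by apply: (addIr (v ⊗p (0 : W))); rewrite -pureDr !add0r. Qed.
Lemma pureZl V W a (v : V) (w : W) : (a *: v) ⊗p w = a *: (v ⊗p w).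
Proof.
by have := (pure_bilin V W).1 w a v 0; rewrite /= !addr0 pure0l addr0.
Qed.
Lemma pureZr V W a (v : V) (w : W) : v ⊗p (a *: w) = a *: (v ⊗p w).
Proof.
by have := (pure_bilin V W).2 v a w 0; rewrite /= !addr0 pure0r addr0.
Qed.

Definition lpure V W (v : V) := fun w : W => v ⊗p w.
Fact lpure_linear V W (v : V) : linear (@lpure V W v).
Proof. exact: (pure_bilin V W).2. Qed.
HB.instance Definition _ V W v :=
  GRing.isLinear.Build K W (V ⊗ W)%type *:%R (@lpure V W v) (@lpure_linear V W v).

Definition rpure V W (w : W) := fun v : V => v ⊗p w.
Fact rpure_linear V W (w : W) : linear (@rpure V W w).
Proof. exact: (pure_bilin V W).1. Qed.
HB.instance Definition _ V W w :=
  GRing.isLinear.Build K V (V ⊗ W)%type *:%R (@rpure V W w) (@rpure_linear V W w).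

End PureTheory.

Arguments lpure {K V} W v.
Arguments rpure {K} V {W} w.

Section TensorMaps.
Variable K : fieldType.
Implicit Types U V W Z : lmodType K.

Fact tmap_bilin V V' W W' (f : {linear V -> V'}) (g : {linear W -> W'}) :
  bilin (fun v w => f v ⊗p g w).
Proof.
split=> [w a v v'|v a w w'] /=.
  by rewrite linearP pureDl pureZl.
by rewrite linearP pureDr pureZr.
Qed.
Definition tmap V V' W W' (f : {linear V -> V'}) (g : {linear W -> W'}) :
  {linear V ⊗ W -> V' ⊗ W'} := tlift (tmap_bilin f g).
Lemma tmapE V V' W W' (f : {linear V -> V'}) (g : {linear W -> W'}) v w :
  tmap f g (v ⊗p w) = f v ⊗p g w.
Proof. exact: tlift_pure. Qed.

Fact twist_bilin V W : bilin (fun (v : V) (w : W) => w ⊗p v).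
Proof.
split=> [w a v v'|v a w w'] /=.
  by rewrite pureDr pureZr.
by rewrite pureDl pureZl.
Qed.
Definition twist V W : {linear V ⊗ W -> W ⊗ V} := tlift (twist_bilin V W).
Lemma twistE V W (v : V) (w : W) : twist V W (v ⊗p w) = w ⊗p v.
Proof. exact: tlift_pure. Qed.

Fact assocl_in_bilin U V W (u : U) :
  bilin (fun (v : V) (w : W) => (u ⊗p v) ⊗p w).
Proof.
split=> [w a v v'|v a w w'] /=.
  by rewrite pureDr pureZr pureDl pureZl.
by rewrite pureDr pureZr.
Qed.
Fact assocl_bilin U V W :
  bilin (fun (u : U) (x : V ⊗ W) => tlift (assocl_in_bilin V W u) x).
Proof.
split=> [x a u u'|u a x x'] /=; last exact: linearP.
have [s ->] := tens_span x; rewrite !(raddf_sum (tlift _)) scaler_sumr -big_split /=.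
by apply: eq_bigr => p _; rewrite !tlift_pure !(pureDl, pureZl).
Qed.
Definition assocl U V W : {linear U ⊗ (V ⊗ W) -> (U ⊗ V) ⊗ W} :=
  tlift (assocl_bilin U V W).
Lemma assoclE U V W (u : U) (v : V) (w : W) :
  assocl U V W (u ⊗p (v ⊗p w)) = (u ⊗p v) ⊗p w.
Proof. by rewrite /assocl !tlift_pure. Qed.

Fact assocr_in_bilin U V W (w : W) :
  bilin (fun (u : U) (v : V) => u ⊗p (v ⊗p w)).
Proof.
split=> [v a u u'|u a v v'] /=.
  by rewrite pureDl pureZl.
by rewrite pureDl pureZl pureDr pureZr.
Qed.
Fact assocr_bilin U V W :
  bilin (fun (x : U ⊗ V) (w : W) => tlift (assocr_in_bilin U V w) x).
Proof.
split=> [w a x x'|x a w w'] /=; first exact: linearP.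
have [s ->] := tens_span x; rewrite !(raddf_sum (tlift _)) scaler_sumr -big_split /=.
by apply: eq_bigr => p _; rewrite !tlift_pure !(pureDr, pureZr).
Qed.
Definition assocr U V W : {linear (U ⊗ V) ⊗ W -> U ⊗ (V ⊗ W)} :=
  tlift (assocr_bilin U V W).
Lemma assocrE U V W (u : U) (v : V) (w : W) :
  assocr U V W ((u ⊗p v) ⊗p w) = u ⊗p (v ⊗p w).
Proof. by rewrite /assocr !tlift_pure. Qed.

(* [Id ⊗ τ ⊗ Id], with the bracketing in which it is applied below *)
Definition midtwist U V W Z : {linear (U ⊗ V) ⊗ (W ⊗ Z) -> (U ⊗ W) ⊗ (V ⊗ Z)} :=
  assocl U W (V ⊗ Z)
  \oL tmap (lid U) (assocr W V Z \oL tmap (twist V W) (lid Z) \oL assocl V W Z)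
  \oL assocr U V (W ⊗ Z).
Lemma midtwistE U V W Z (u : U) (v : V) (w : W) (z : Z) :
  midtwist U V W Z ((u ⊗p v) ⊗p (w ⊗p z)) = (u ⊗p w) ⊗p (v ⊗p z).
Proof.
by rewrite /midtwist !(lcompE, lidE, assocrE, tmapE, assoclE, twistE).
Qed.

End TensorMaps.

(** * Comodule-algebras *)

Section ComoduleAlgebra.
Variable K : fieldType.

(* [A] need not be unital *)
Definition associative_mul (A : lmodType K) (mu : {linear A ⊗ A -> A}) : Prop :=
  mu \oL tmap mu (lid A) =1 mu \oL tmap (lid A) mu \oL assocr A A A.

(* [(μ_B ⊗ μ_A) ∘ (Id_B ⊗ τ ⊗ Id_A)] : the multiplication of [B ⊗ A] *)
Definition tens_mul (B A : lmodType K)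
    (muB : {linear B ⊗ B -> B}) (muA : {linear A ⊗ A -> A}) :
  {linear (B ⊗ A) ⊗ (B ⊗ A) -> B ⊗ A} :=
  tmap muB muA \oL midtwist B A B A.

Fact alg_mul_bilin (H : algType K) : bilin (fun x y : H => x * y).
Proof.
split=> [y a x x'|x a y y'] /=.
  by rewrite mulrDl scalerAl.
by rewrite mulrDr scalerAr.
Qed.
Definition alg_mul (H : algType K) : {linear H ⊗ H -> H} :=
  tlift (alg_mul_bilin H).
Lemma alg_mulE (H : algType K) (x y : H) : alg_mul H (x ⊗p y) = x * y.
Proof. exact: tlift_pure. Qed.

Record is_bialgebra (H : algType K)
    (Delta : {linear H -> H ⊗ H}) (eps : {linear H -> K^o}) : Prop := {
  comulA : tmap Delta (lid H) \oL Delta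
           =1 assocl H H H \oL tmap (lid H) Delta \oL Delta;
  counitl : forall x, tmap eps (lid H) (Delta x) = 1 ⊗p x;
  counitr : forall x, tmap (lid H) eps (Delta x) = x ⊗p 1;
  comulM : Delta \oL alg_mul H
           =1 tens_mul (alg_mul H) (alg_mul H) \oL tmap Delta Delta;
  comul1 : Delta 1 = 1 ⊗p 1;
  counitM : forall x y, eps (x * y) = eps x * eps y;
  counit1 : eps 1 = 1
}.

Record is_comodule (H : algType K) (Delta : {linear H -> H ⊗ H})
    (eps : {linear H -> K^o}) (A : lmodType K) (rho : {linear A -> H ⊗ A}) :
    Prop := {
  coactA : tmap (lid H) rho \oL rho =1 assocr H H A \oL tmap Delta (lid A) \oL rho;
  coact_counit : forall a, tmap eps (lid A) (rho a) = 1 ⊗p a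
}.

Record is_comodule_algebra (H : algType K) (Delta : {linear H -> H ⊗ H})
    (eps : {linear H -> K^o}) (A : lmodType K) (mu : {linear A ⊗ A -> A})
    (rho : {linear A -> H ⊗ A}) : Prop := {
  coact_comodule : is_comodule Delta eps rho;
  coactM : rho \oL mu =1 tens_mul (alg_mul H) mu \oL tmap rho rho
}.

End ComoduleAlgebra.

(** * Formal power series of linear maps

    A series [Σ_i f_i t^i] with [f_i] in [Hom(V, W)] is the sequence of its
    coefficients; composition and tensor product are extended [t]-linearly. *)

Section PowerSeries.
Variable K : fieldType.

Definition series (V W : lmodType K) := nat -> {linear V -> W}.

Definition sconst (V W : lmodType K) (f : {linear V -> W}) : series V W :=
  fun n => if n is 0 then f else 0.

Definition scomp (U V W : lmodType K) (F : series V W) (G : series U V) :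
  series U W := fun n => \sum_(i < n.+1) (F i \oL G (n - i)%N).

Definition smap (V V' W W' : lmodType K) (F : series V V') (G : series W W') :
  series (V ⊗ W) (V' ⊗ W') := fun n => \sum_(i < n.+1) tmap (F i) (G (n - i)%N).

End PowerSeries.

Notation "F \oS G" := (scomp F G) (at level 40, left associativity).

Section Deformation.
Variables (K : fieldType) (H : algType K) (Delta : {linear H -> H ⊗ H}).
Variables (A : lmodType K) (mu : {linear A ⊗ A -> A}) (rho : {linear A -> H ⊗ A}).

Record is_deformation (R : series A (H ⊗ A)) : Prop := {
  deform0 : R 0 = rho;
  deformA : smap (sconst (lid H)) R \oS R
            =1 sconst (assocr H H A \oL tmap Delta (lid A)) \oS R;
  deformM : R \oS sconst mu =1 sconst (tens_mul (alg_mul H) mu) \oS smap R R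
}.

Definition infinitesimal (R : series A (H ⊗ A)) : {linear A -> H ⊗ A} := R 1.

Record is_formal_automorphism (Phi : series A A) : Prop := {
  formal_aut0 : Phi 0 = lid A;
  formal_autM : Phi \oS sconst mu =1 sconst mu \oS smap Phi Phi
}.

Definition is_series_inverse (Phi Psi : series A A) : Prop :=
  Psi \oS Phi =1 sconst (lid A) /\ Phi \oS Psi =1 sconst (lid A).

Definition equivalent (R R' : series A (H ⊗ A)) : Prop :=
  exists Phi Psi : series A A,
    [/\ is_formal_automorphism Phi, is_series_inverse Phi Psi &
        R' =1 smap (sconst (lid H)) Psi \oS R \oS Phi].

Definition rigid : Prop :=
  forall R, is_deformation R -> equivalent R (sconst rho).

End Deformation.

(** * Cochain complexes *)

Section Cohomology.
Variables (K : fieldType) (C : nat -> lmodType K) (d : forall n, C n -> C n.+1).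

Definition is_cocycle (n : nat) (x : C n) : Prop := d x = 0.

Definition cohomologous (n : nat) : C n -> C n -> Prop :=
  match n with
  | 0 => fun x x' => x = x'
  | m.+1 => fun x x' => exists y : C m, x - x' = d y
  end.

(* [H^n(C) = 0] *)
Definition cohomology_trivial (n : nat) : Prop :=
  forall x : C n, is_cocycle x -> cohomologous x 0.

End Cohomology.

Arguments is_cocycle {K C} d n x.
Arguments cohomologous {K C} d n x x'.
Arguments cohomology_trivial {K C} d n.

Section Powers.
Variable K : fieldType.

(* [H^{⊗n} ⊗ A], bracketed as [H ⊗ (H ⊗ (... ⊗ A))] *)
Fixpoint htpow (H A : lmodType K) (n : nat) : lmodType K :=
  if n is n'.+1 then H ⊗ htpow H A n' else A.

(* [A^{⊗n}], bracketed as [A ⊗ (A ⊗ (... ⊗ A))], with [A^{⊗1} = A] *)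
Fixpoint tpow (A : lmodType K) (n : nat) : lmodType K :=
  match n with
  | 0 => K^o
  | n'.+1 => if n' is 0 then A else A ⊗ tpow A n'
  end.

(* [Id_{A^{⊗j}} ⊗ μ ⊗ Id_{A^{⊗(n-j)}}] for [j <= n] *)
Fixpoint mul_at (A : lmodType K) (mu : {linear A ⊗ A -> A}) (j n : nat) :
    {linear tpow A n.+2 -> tpow A n.+1} :=
  match n, j with
  | 0, 0 => mu
  | 0, _.+1 => 0
  | n'.+1, 0 => tmap mu (lid (tpow A n'.+1)) \oL assocl A A (tpow A n'.+1)
  | n'.+1, j'.+1 => tmap (lid A) (mul_at mu j' n')
  end.

(* the identification [A^{⊗(n+2)} = A^{⊗(n+1)} ⊗ A] *)
Fixpoint tpow_unsnoc (A : lmodType K) (n : nat) :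
    {linear tpow A n.+2 -> tpow A n.+1 ⊗ A} :=
  match n with
  | 0 => lid (A ⊗ A)%type
  | n'.+1 => assocl A (tpow A n'.+1) A \oL tmap (lid A) (tpow_unsnoc A n')
  end.

(* [Id_{H^{⊗j}} ⊗ Δ ⊗ Id_{H^{⊗(n-1-j)} ⊗ A}] for [j < n] *)
Fixpoint comul_at (H A : lmodType K) (Delta : {linear H -> H ⊗ H}) (j n : nat) :
    {linear htpow H A n -> htpow H A n.+1} :=
  match n, j with
  | 0, _ => 0
  | n'.+1, 0 => assocr H H (htpow H A n') \oL tmap Delta (lid (htpow H A n'))
  | n'.+1, j'.+1 => tmap (lid H) (comul_at A Delta j' n')
  end.

(* [Id_{H^{⊗n}} ⊗ ρ] *)
Fixpoint coact_at (H A : lmodType K) (rho : {linear A -> H ⊗ A}) (n : nat) :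
    {linear htpow H A n -> htpow H A n.+1} :=
  if n is n'.+1 then tmap (lid H) (coact_at rho n') else rho.

End Powers.

Section Hochschild.
Variables (K : fieldType) (A : lmodType K) (mu : {linear A ⊗ A -> A}).

Definition Ch (n : nat) : lmodType K := {linear tpow A n -> A}.

Definition dh0 (phi : {linear K^o -> A}) : {linear A -> A} :=
  mu \oL rpure A (phi 1) - mu \oL lpure A (phi 1).

Definition dhS (m : nat) (phi : {linear tpow A m.+1 -> A}) :
    {linear tpow A m.+2 -> A} :=
  mu \oL tmap (lid A) phi
  + \sum_(1 <= i < m.+2) (-1) ^+ i *: (phi \oL mul_at mu i.-1 m)
  + (-1) ^+ m.+2 *: (mu \oL tmap phi (lid A) \oL tpow_unsnoc A m).

Definition dh (n : nat) : Ch n -> Ch n.+1 :=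
  match n with
  | 0 => dh0
  | m.+1 => @dhS m
  end.

End Hochschild.

Arguments dh {K A} mu n phi.

Section Derivations.
Variables (K : fieldType) (A : lmodType K) (mu : {linear A ⊗ A -> A}).

Definition is_derivation (phi : {linear A -> A}) : Prop :=
  forall a b, phi (mu (a ⊗p b)) = mu (phi a ⊗p b) + mu (a ⊗p phi b).

Definition derivation_pred : {pred {linear A -> A}} :=
  fun phi => `[< is_derivation phi >].

Fact derivation_submod : submod_closed derivation_pred.
Proof.
split=> [|c f g /asboolP df /asboolP dg]; apply/asboolP => a b.
  by rewrite !hom0E pure0l pure0r !(raddf0 mu) addr0.
rewrite !homDE !homZE df dg pureDl pureDr pureZl pureZr.
by rewrite !(linearD mu) !(linearZZ mu) scalerDr addrACA.
Qed.
HB.instance Definition _ :=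
  GRing.isSubmodClosed.Build K {linear A -> A} derivation_pred derivation_submod.

Record Der := MkDer {
  der_val :> {linear A -> A};
  der_valP : der_val \in derivation_pred
}.
HB.instance Definition _ := [isSub for der_val].
HB.instance Definition _ := [Choice of Der by <:].
HB.instance Definition _ := [SubChoice_isSubLmodule of Der by <:].

End Derivations.

Section ComoduleAlgebraComplex.
Variables (K : fieldType) (H : algType K) (Delta : {linear H -> H ⊗ H}).
Variables (A : lmodType K) (mu : {linear A ⊗ A -> A}) (rho : {linear A -> H ⊗ A}).

Definition Fca (n : nat) : lmodType K :=
  match n with
  | 0 => Der mu
  | 1 => {linear A -> H ⊗ A}
  | _ => ({linear A -> htpow H A n} * {linear tpow A n -> H ⊗ A})%type
  end.

Definition dca0 (n : nat) (phi : {linear A -> htpow H A n}) :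
    {linear A -> htpow H A n.+1} :=
  coact_at rho n \oL phi
  + \sum_(1 <= i < n.+1) (-1) ^+ i *: (comul_at A Delta (n - i) n \oL phi)
  + (-1) ^+ n.+1 *: (tmap (lid H) phi \oL rho).

(* the component [d^{m+1}_{ca,1}] *)
Definition dca1 (m : nat) (phi : {linear tpow A m.+1 -> H ⊗ A}) :
    {linear tpow A m.+2 -> H ⊗ A} :=
  tens_mul (alg_mul H) mu \oL tmap rho phi
  + \sum_(1 <= i < m.+2) (-1) ^+ i *: (phi \oL mul_at mu i.-1 m)
  + (-1) ^+ m.+2 *:
      (tens_mul (alg_mul H) mu \oL tmap phi rho \oL tpow_unsnoc A m).

Definition dca_der (phi : Der mu) : {linear A -> H ⊗ A} :=
  rho \oL phi - tmap (lid H) phi \oL rho.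

Definition dca (n : nat) : Fca n -> Fca n.+1 :=
  match n with
  | 0 => dca_der
  | 1 => fun phi => (@dca0 1 phi, @dca1 0 phi)
  | m.+2 => fun phi => (@dca0 m.+2 phi.1, @dca1 m.+1 phi.2)
  end.

End ComoduleAlgebraComplex.

Arguments Fca {K} H {A} mu n.
Arguments dca {K H} Delta {A} mu rho n phi.

(* Main.v *)
(** A sequence of maps is a solution of the deformation equations as soon as it
    is one modulo every [t^n].  The first coefficient at which a truncated
    solution fails is a cocycle, by an alternating-sum identity valid for all
    power series; changing the [n]-th coefficient of the solution by [f] changes
    the failure by [- d f], so a vanishing [H^2] lets the solution be extended.

    Rigidity is obtained in the same way, by solving [R ∘ Φ = (Id_H ⊗ Φ) ∘ ρ]
    for a formal automorphism [Φ], one coefficient at a time: [H^2_h(A, A) = 0]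
    extends [Φ] as an automorphism, after which the failure of the equation is a
    1-cocycle, hence the coboundary of a derivation, and subtracting that
    derivation from [Φ_n] keeps [Φ] multiplicative. *)

Require Import Defs.
From HB Require Import structures.
From mathcomp Require Import all_boot all_algebra.
From mathcomp Require Import boolp.

Set Implicit Arguments.
Unset Strict Implicit.
Unset Printing Implicit Defensive.

Import GRing.Theory.
Local Open Scope ring_scope.

(** * Linear maps and tensor products *)

Section LinearMaps.
Variable K : fieldType.
Implicit Types U V W X Y Z : lmodType K.

Lemma lcompA U V W X (f : {linear W -> X}) (g : {linear V -> W})
  (h : {linear U -> V}) : f \oL (g \oL h) = f \oL g \oL h.
Proof. exact: linear_ext. Qed.

Lemma lcomp1l V W (f : {linear V -> W}) : lid W \oL f = f.
Proof. exact: linear_ext. Qed.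

Lemma lcomp1r V W (f : {linear V -> W}) : f \oL lid V = f.
Proof. exact: linear_ext. Qed.

Lemma lcompDl U V W (f f' : {linear V -> W}) (g : {linear U -> V}) :
  (f + f') \oL g = f \oL g + f' \oL g.
Proof. exact: linear_ext. Qed.

Lemma lcompDr U V W (f : {linear V -> W}) (g g' : {linear U -> V}) :
  f \oL (g + g') = f \oL g + f \oL g'.
Proof. by apply: linear_ext => x; rewrite lcompE (linearD f). Qed.

Lemma lcompNr U V W (f : {linear V -> W}) (g : {linear U -> V}) :
  f \oL (- g) = - (f \oL g).
Proof. by apply: linear_ext => x; rewrite lcompE (linearN f). Qed.

Lemma lcomp0l U V W (g : {linear U -> V}) : (0 : {linear V -> W}) \oL g = 0.
Proof. exact: linear_ext. Qed.

Lemma lcomp0r U V W (f : {linear V -> W}) : f \oL (0 : {linear U -> V}) = 0.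
Proof. by apply: linear_ext => x; exact: (linear0 f). Qed.

Lemma lcomp_suml U V W (I : Type) (r : seq I) (F : I -> {linear V -> W})
  (g : {linear U -> V}) :
  (\sum_(i <- r) F i) \oL g = \sum_(i <- r) (F i \oL g).
Proof. by apply: linear_ext => x; rewrite lcompE !hom_sumE. Qed.

Lemma lcomp_sumr U V W (I : Type) (r : seq I) (f : {linear V -> W})
  (G : I -> {linear U -> V}) :
  f \oL (\sum_(i <- r) G i) = \sum_(i <- r) (f \oL G i).
Proof.
by apply: linear_ext => x; rewrite lcompE !hom_sumE (linear_sum f).
Qed.

Lemma tmap_comp U V W X Y Z (f : {linear V -> W}) (f' : {linear U -> V})
  (g : {linear Y -> Z}) (g' : {linear X -> Y}) :
  tmap f g \oL tmap f' g' = tmap (f \oL f') (g \oL g').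
Proof. by apply: tens_ext => v w; rewrite lcompE !tmapE. Qed.

Lemma tmap1 V W : tmap (lid V) (lid W) = lid (V ⊗ W)%type.
Proof. by apply: tens_ext => v w; rewrite tmapE. Qed.

Lemma tmapDl V W X Y (f f' : {linear V -> W}) (g : {linear X -> Y}) :
  tmap (f + f') g = tmap f g + tmap f' g.
Proof. by apply: tens_ext => v w; rewrite homDE !tmapE homDE pureDl. Qed.

Lemma tmapDr V W X Y (f : {linear V -> W}) (g g' : {linear X -> Y}) :
  tmap f (g + g') = tmap f g + tmap f g'.
Proof. by apply: tens_ext => v w; rewrite homDE !tmapE homDE pureDr. Qed.

Lemma tmap0l V W X Y (g : {linear X -> Y}) : tmap (0 : {linear V -> W}) g = 0.
Proof. by apply: tens_ext => v w; rewrite tmapE hom0E pure0l. Qed.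

Lemma tmap0r V W X Y (f : {linear V -> W}) : tmap f (0 : {linear X -> Y}) = 0.
Proof. by apply: tens_ext => v w; rewrite tmapE hom0E pure0r. Qed.

Lemma tmapNl V W X Y (f : {linear V -> W}) (g : {linear X -> Y}) :
  tmap (- f) g = - tmap f g.
Proof. by apply/eqP; rewrite -addr_eq0 -tmapDl addNr tmap0l. Qed.

Lemma tmapNr V W X Y (f : {linear V -> W}) (g : {linear X -> Y}) :
  tmap f (- g) = - tmap f g.
Proof. by apply/eqP; rewrite -addr_eq0 -tmapDr addNr tmap0r. Qed.

Lemma tmap_suml V W X Y (I : Type) (r : seq I) (F : I -> {linear V -> W})
  (g : {linear X -> Y}) :
  tmap (\sum_(i <- r) F i) g = \sum_(i <- r) tmap (F i) g.
Proof.
by elim/big_rec2: _ => [|i f f' _ <-]; rewrite (tmapDl, tmap0l).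
Qed.

Lemma tmap_sumr V W X Y (I : Type) (r : seq I) (f : {linear V -> W})
  (G : I -> {linear X -> Y}) :
  tmap f (\sum_(i <- r) G i) = \sum_(i <- r) tmap f (G i).
Proof. by elim/big_rec2: _ => [|i g g' _ <-]; rewrite (tmapDr, tmap0r). Qed.

Lemma tens_ext3l U V W X (f g : {linear (U ⊗ V) ⊗ W -> X}) :
  (forall u v w, f ((u ⊗p v) ⊗p w) = g ((u ⊗p v) ⊗p w)) -> f = g.
Proof.
move=> e; apply: tens_ext => x w; have [s ->] := tens_span x.
(* Folding [_ ⊗p w] into the linear map [rpure _ w] lets it pass through the sum of pure tensors. *)
rewrite -/(rpure _ w _) !linear_sum; apply: eq_bigr => p _; exact: e.
Qed.

Lemma tens_ext3r U V W X (f g : {linear U ⊗ (V ⊗ W) -> X}) :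
  (forall u v w, f (u ⊗p (v ⊗p w)) = g (u ⊗p (v ⊗p w))) -> f = g.
Proof.
move=> e; apply: tens_ext => u x; have [s ->] := tens_span x.
rewrite -/(lpure _ u _) !linear_sum; apply: eq_bigr => p _; exact: e.
Qed.

Lemma assocr_nat U V W X Y Z (f : {linear U -> X}) (g : {linear V -> Y})
  (h : {linear W -> Z}) :
  assocr X Y Z \oL tmap (tmap f g) h = tmap f (tmap g h) \oL assocr U V W.
Proof.
by apply: tens_ext3l => u v w; rewrite !lcompE !(tmapE, assocrE).
Qed.

Lemma assocl_nat U V W X Y Z (f : {linear U -> X}) (g : {linear V -> Y})
  (h : {linear W -> Z}) :
  assocl X Y Z \oL tmap f (tmap g h) = tmap (tmap f g) h \oL assocl U V W.
Proof.
by apply: tens_ext3r => u v w; rewrite !lcompE !(tmapE, assoclE).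
Qed.

Lemma tens_ext4 U V W X Y (f g : {linear (U ⊗ V) ⊗ (W ⊗ X) -> Y}) :
  (forall u v w x, f ((u ⊗p v) ⊗p (w ⊗p x)) = g ((u ⊗p v) ⊗p (w ⊗p x))) ->
  f = g.
Proof.
move=> e; apply: tens_ext3l => u v y; have [s ->] := tens_span y.
rewrite -/(lpure _ (u ⊗p v) _) !linear_sum; apply: eq_bigr => p _; exact: e.
Qed.

Lemma midtwist_nat U V W X Y Z (f : {linear V -> Y}) (g : {linear X -> Z}) :
  midtwist U Y W Z \oL tmap (tmap (lid U) f) (tmap (lid W) g)
  = tmap (lid (U ⊗ W)%type) (tmap f g) \oL midtwist U V W X.
Proof.
apply: tens_ext4 => u v w x; rewrite lcompE [RHS]lcompE.
by rewrite !tmapE !midtwistE !tmapE.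
Qed.

End LinearMaps.

(** * Formal power series *)

Section SeriesZmodule.
Variables (K : fieldType) (V W : lmodType K).
Implicit Types F G : series V W.

HB.instance Definition _ := gen_eqMixin (series V W).
HB.instance Definition _ := gen_choiceMixin (series V W).

(** An additive structure on whole series allows the obstruction identities to be proved once,
    before any coefficient is extracted. *)
Definition series0 : series V W := fun=> 0.
Definition seriesD F G : series V W := fun n => F n + G n.
Definition seriesN F : series V W := fun n => - F n.

Fact seriesDA : associative seriesD.
Proof. by move=> F G H; apply/funext => n; exact: addrA. Qed.
Fact seriesDC : commutative seriesD.
Proof. by move=> F G; apply/funext => n; exact: addrC. Qed.
Fact series0D : left_id series0 seriesD.
Proof. by move=> F; apply/funext => n; exact: add0r. Qed.
Fact seriesND : left_inverse series0 seriesN seriesD.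
Proof. by move=> F; apply/funext => n; exact: addNr. Qed.
HB.instance Definition _ :=
  GRing.isZmodule.Build (series V W) seriesDA seriesDC series0D seriesND.

Lemma seriesDE F G n : (F + G) n = F n + G n. Proof. by []. Qed.
Lemma seriesNE F n : (- F) n = - F n. Proof. by []. Qed.
Lemma seriesBE F G n : (F - G) n = F n - G n. Proof. by []. Qed.

End SeriesZmodule.

(** * Composition and tensor products of series *)

Section SeriesComposition.
Variable K : fieldType.
Implicit Types U V W X Y Z : lmodType K.

Lemma scompA U V W X (F : series W X) (G : series V W) (L : series U V) :
  F \oS (G \oS L) = F \oS G \oS L.
Proof.
apply/funext => i; rewrite /scomp.
(* In [coef3 j k] the outer indices [j] and [k] belong to [F] and [L], and [G] takes the remaining
   degree. Both bracketings become sums of [coef3] over [j + k <= i]. *)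
pose coef3 j k := F j \oL (G (i - j - k)%N \oL L k).
transitivity (\sum_(j < i.+1) \sum_(k < i.+1 | (k <= i - j)%N) coef3 j k).
  apply: eq_bigr => /= j _; rewrite lcomp_sumr.
  rewrite (big_ord_narrow_leq (leq_subr _ _)) /= (reindex_inj rev_ord_inj) /=.
  apply: eq_bigr => k _; rewrite /coef3 /= subSS; congr (_ \oL (_ \oL L _)).
  by rewrite subKn // -ltnS.
rewrite (exchange_big_dep predT) //= (reindex_inj rev_ord_inj) /=.
apply: eq_bigr => k _; rewrite subSS lcomp_suml.
transitivity (\sum_(j < i.+1 | (j <= k)%N) coef3 j (i - k)%N).
  apply: eq_bigl => j; have lt_j := ltn_ord j; have lt_k := ltn_ord k.
  by rewrite leq_sub2lE.
rewrite (big_ord_narrow_leq (leq_ord k)) /=.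
apply: eq_bigr => j _; rewrite /coef3 -lcompA /=; congr (_ \oL (G _ \oL _)).
by rewrite subnAC subKn // leq_ord.
Qed.

Lemma scompDl U V W (F F' : series V W) (G : series U V) :
  (F + F') \oS G = F \oS G + F' \oS G.
Proof.
apply/funext => n; rewrite seriesDE /scomp -big_split.
by apply: eq_bigr => i _; exact: lcompDl.
Qed.

Lemma scompDr U V W (F : series V W) (G G' : series U V) :
  F \oS (G + G') = F \oS G + F \oS G'.
Proof.
apply/funext => n; rewrite seriesDE /scomp -big_split.
by apply: eq_bigr => i _; exact: lcompDr.
Qed.

Lemma scompBl U V W (F F' : series V W) (G : series U V) :
  (F - F') \oS G = F \oS G - F' \oS G.
Proof. by apply/eqP; rewrite eq_sym subr_eq -scompDl subrK. Qed.

Lemma scompBr U V W (F : series V W) (G G' : series U V) :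
  F \oS (G - G') = F \oS G - F \oS G'.
Proof. by apply/eqP; rewrite eq_sym subr_eq -scompDr subrK. Qed.

Lemma sconst_scompE U V W (f : {linear V -> W}) (G : series U V) n :
  (sconst f \oS G) n = f \oL G n.
Proof.
rewrite /scomp big_ord_recl subn0 big1 ?addr0 // => i _; exact: lcomp0l.
Qed.

Lemma scomp_sconstE U V W (F : series V W) (g : {linear U -> V}) n :
  (F \oS sconst g) n = F n \oL g.
Proof.
rewrite /scomp big_ord_recr subnn big1 => [|i _]; first exact: add0r.
by rewrite /= -(subnSK (ltn_ord i)) lcomp0r.
Qed.

Lemma sconst_comp U V W (f : {linear V -> W}) (g : {linear U -> V}) :
  sconst f \oS sconst g = sconst (f \oL g).
Proof.
by apply/funext => -[|n]; rewrite sconst_scompE //= lcomp0r.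
Qed.

Lemma scomp1l V W (F : series V W) : sconst (lid W) \oS F = F.
Proof. by apply/funext => n; rewrite sconst_scompE lcomp1l. Qed.

Lemma scomp1r V W (F : series V W) : F \oS sconst (lid V) = F.
Proof. by apply/funext => n; rewrite scomp_sconstE lcomp1r. Qed.

Lemma scompE0 U V W (F : series V W) (G : series U V) :
  (F \oS G) 0 = F 0 \oL G 0.
Proof. by rewrite /scomp big_ord1. Qed.

Lemma scompE1 U V W (F : series V W) (G : series U V) :
  (F \oS G) 1 = F 0 \oL G 1 + F 1 \oL G 0.
Proof. by rewrite /scomp big_ord_recr big_ord1. Qed.

(** Tensoring with an identity on one side is functorial, so splitting [smap] into two such
    whiskerings reduces tensor products of series to composition. *)
Definition lwhisk V V' W (F : series V V') : series (V ⊗ W) (V' ⊗ W) :=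
  fun n => tmap (F n) (lid W).

Definition rwhisk V W W' (F : series W W') : series (V ⊗ W) (V ⊗ W') :=
  fun n => tmap (lid V) (F n).

Lemma lwhisk_comp U V X W (F : series V X) (G : series U V) :
  lwhisk W (F \oS G) = lwhisk W F \oS lwhisk W G.
Proof.
apply/funext => n; rewrite /lwhisk /scomp tmap_suml.
by apply: eq_bigr => i _; rewrite tmap_comp lcomp1l.
Qed.

Lemma rwhisk_comp U V X W (F : series V X) (G : series U V) :
  rwhisk W (F \oS G) = rwhisk W F \oS rwhisk W G.
Proof.
apply/funext => n; rewrite /rwhisk /scomp tmap_sumr.
by apply: eq_bigr => i _; rewrite tmap_comp lcomp1l.
Qed.

Lemma lwhisk_sconst V V' W (f : {linear V -> V'}) :
  lwhisk W (sconst f) = sconst (tmap f (lid W)).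
Proof. by apply/funext => -[|n] //; exact: tmap0l. Qed.

Lemma rwhisk_sconst V V' W (f : {linear V -> V'}) :
  rwhisk W (sconst f) = sconst (tmap (lid W) f).
Proof. by apply/funext => -[|n] //; exact: tmap0r. Qed.

Lemma rwhiskD V W W' (F G : series W W') :
  rwhisk V (F + G) = rwhisk V F + rwhisk V G.
Proof. by apply/funext => n; exact: tmapDr. Qed.

Lemma rwhiskB V W W' (F G : series W W') :
  rwhisk V (F - G) = rwhisk V F - rwhisk V G.
Proof. by apply/eqP; rewrite eq_sym subr_eq -rwhiskD subrK. Qed.

Lemma smap_lr V V' W W' (F : series V V') (G : series W W') :
  smap F G = lwhisk W' F \oS rwhisk V G.
Proof.
apply/funext => n; apply: eq_bigr => i _.
by rewrite tmap_comp lcomp1l lcomp1r.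
Qed.

(** Maps acting on different factors commute, but the Cauchy sum now runs over the other index and
    has to be reversed. Together with [smap_lr] this is the interchange law. *)
Lemma smap_rl V V' W W' (F : series V V') (G : series W W') :
  smap F G = rwhisk V' G \oS lwhisk W F.
Proof.
apply/funext => n; rewrite /smap (reindex_inj rev_ord_inj) /=.
apply: eq_bigr => i _; rewrite subSS subKn ?leq_ord //.
by rewrite tmap_comp lcomp1l lcomp1r.
Qed.

Lemma smap_lid1 V W W' (G : series W W') : smap (sconst (lid V)) G = rwhisk V G.
Proof. by rewrite smap_lr lwhisk_sconst tmap1 scomp1l. Qed.

Lemma smap_comp U V W X Y Z (F : series V W) (F' : series U V)
  (G : series Y Z) (G' : series X Y) :
  smap F G \oS smap F' G' = smap (F \oS F') (G \oS G').
Proof.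
rewrite !smap_lr lwhisk_comp rwhisk_comp -!scompA; congr (_ \oS _).
(* Only the two middle whiskerings are in the wrong order; they are exchanged through [smap]. *)
by rewrite !scompA -smap_rl smap_lr.
Qed.

Lemma smapBl V W X Y (F F' : series V W) (G : series X Y) :
  smap (F - F') G = smap F G - smap F' G.
Proof.
rewrite !smap_rl -scompBr; congr (_ \oS _); apply/funext => n.
by rewrite /lwhisk !seriesBE tmapDl tmapNl.
Qed.

Lemma smapBr V W X Y (F : series V W) (G G' : series X Y) :
  smap F (G - G') = smap F G - smap F G'.
Proof. by rewrite !smap_lr -scompBr -rwhiskB. Qed.

(** The associator is natural for constant maps; whiskering isolates one series at a time, and each
    is moved across coefficient by coefficient. *)
Lemma sconst_assocl_smap U V W X Y Z (F : series U X) (G : series V Y)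
  (L : series W Z) :
  sconst (assocl X Y Z) \oS smap F (smap G L)
  = smap (smap F G) L \oS sconst (assocl U V W).
Proof.
rewrite !smap_lr rwhisk_comp lwhisk_comp !scompA.
have -> : sconst (assocl X Y Z) \oS lwhisk _ F
          = lwhisk _ (lwhisk _ F) \oS sconst (assocl U Y Z).
  apply/funext => n; rewrite sconst_scompE scomp_sconstE /lwhisk.
  by rewrite -assocl_nat tmap1.
rewrite -!scompA; congr (_ \oS _); rewrite !scompA.
have -> : sconst (assocl U Y Z) \oS rwhisk _ (lwhisk _ G)
          = lwhisk _ (rwhisk _ G) \oS sconst (assocl U V Z).
  apply/funext => n; rewrite sconst_scompE scomp_sconstE /lwhisk.
  by rewrite -assocl_nat.
rewrite -!scompA; congr (_ \oS _).
apply/funext => n; rewrite sconst_scompE scomp_sconstE /rwhisk.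
by rewrite assocl_nat tmap1.
Qed.

Lemma sconst_midtwist_smap U V W X Y Z (F : series V Y) (G : series X Z) :
  sconst (midtwist U Y W Z) \oS smap (rwhisk U F) (rwhisk W G)
  = rwhisk (U ⊗ W)%type (smap F G) \oS sconst (midtwist U V W X).
Proof.
rewrite !smap_lr rwhisk_comp scompA.
have -> : sconst (midtwist U Y W Z) \oS lwhisk _ (rwhisk _ F)
          = rwhisk _ (lwhisk _ F) \oS sconst (midtwist U V W Z).
  apply/funext => n; rewrite sconst_scompE scomp_sconstE /lwhisk /rwhisk.
  by rewrite -midtwist_nat tmap1.
rewrite -!scompA; congr (_ \oS _).
apply/funext => n; rewrite sconst_scompE scomp_sconstE /rwhisk.
by rewrite -midtwist_nat tmap1.
Qed.

End SeriesComposition.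

(** * Truncated power series *)

Section Truncation.
Variable K : fieldType.
Implicit Types (U V W X Y : lmodType K) (n : nat).

Definition eqmod V W n (F G : series V W) : Prop :=
  forall i, (i < n)%N -> F i = G i.

Lemma eqmod_sym V W n (F G : series V W) : eqmod n F G -> eqmod n G F.
Proof. by move=> e i lt_in; rewrite e. Qed.

Lemma eqmod_trans V W n (F G L : series V W) :
  eqmod n F G -> eqmod n G L -> eqmod n F L.
Proof. by move=> e e' i lt_in; rewrite e // e'. Qed.

Lemma eqmodS V W n (F G : series V W) :
  eqmod n F G -> F n = G n -> eqmod n.+1 F G.
Proof. by move=> e en i; rewrite ltnS leq_eqVlt => /orP[/eqP-> //|/e]. Qed.

Lemma eqmod_leq V W m n (F G : series V W) :
  (m <= n)%N -> eqmod n F G -> eqmod m F G.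
Proof. by move=> le_mn e i lt_im; apply: e; apply: leq_trans le_mn. Qed.

Lemma eqmod_sub V W n (F G : series V W) : eqmod n F G -> eqmod n (F - G) 0.
Proof. by move=> e i /e; rewrite seriesBE => ->; rewrite subrr. Qed.

Lemma eqmodB V W n (F F' G G' : series V W) :
  eqmod n F F' -> eqmod n G G' -> eqmod n (F - G) (F' - G').
Proof. by move=> eF eG i lt_in; rewrite !seriesBE eF ?eG. Qed.

Lemma eqmod_all V W n0 (F G : series V W) :
  (forall n, (n0 <= n)%N -> eqmod n F G) -> F = G.
Proof.
move=> e; apply/funext => i.
apply: (e (n0 + i.+1)%N (leq_addr _ _)); exact: leq_addl.
Qed.

Lemma eqmod_scomp U V W n (F F' : series V W) (G G' : series U V) :
  eqmod n F F' -> eqmod n G G' -> eqmod n (F \oS G) (F' \oS G').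
Proof.
move=> eF eG i lt_in; apply: eq_bigr => j _.
rewrite eF ?eG //; first exact: leq_ltn_trans (leq_subr _ _) lt_in.
exact: leq_ltn_trans (leq_ord j) lt_in.
Qed.

Lemma eqmod_rwhisk V W W' n (F G : series W W') :
  eqmod n F G -> eqmod n (rwhisk V F) (rwhisk V G).
Proof. by move=> e i lt_in; rewrite /rwhisk e. Qed.

Lemma eqmod_lwhisk V W W' n (F G : series W W') :
  eqmod n F G -> eqmod n (lwhisk V F) (lwhisk V G).
Proof. by move=> e i lt_in; rewrite /lwhisk e. Qed.

Lemma eqmod_smap V W X Y n (F F' : series V W) (G G' : series X Y) :
  eqmod n F F' -> eqmod n G G' -> eqmod n (smap F G) (smap F' G').
Proof.
by move=> eF eG; rewrite !smap_lr; apply: eqmod_scomp;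
  [exact: eqmod_lwhisk | exact: eqmod_rwhisk].
Qed.

(** If [G] starts in degree [n], the coefficient of [t^n] can only pair the constant term of [F]
    with the leading term of [G]. This is how identities between series become cocycle
    conditions. *)
Lemma scomp_leadr U V W n (F : series V W) (G : series U V) :
  eqmod n G 0 -> (F \oS G) n = F 0 \oL G n.
Proof.
move=> e; rewrite /scomp big_ord_recl subn0 big1 => [|i _]; first exact: addr0.
by rewrite e ?lcomp0r // lift0 subnSK // leq_subr.
Qed.

Lemma scomp_leadl U V W n (F : series V W) (G : series U V) :
  eqmod n F 0 -> (F \oS G) n = F n \oL G 0.
Proof.
move=> e; rewrite /scomp big_ord_recr subnn big1 => [|i _]; first exact: add0r.
by rewrite e ?(ltn_ord i) //; exact: lcomp0l.
Qed.

Lemma smap_leadr V W X Y n (F : series V W) (G : series X Y) :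
  eqmod n G 0 -> smap F G n = tmap (F 0) (G n).
Proof.
move=> e; rewrite smap_lr scomp_leadr ?tmap_comp ?lcomp1l ?lcomp1r //.
by move=> i /e; rewrite /rwhisk => ->; exact: tmap0r.
Qed.

Lemma smap_leadl V W X Y n (F : series V W) (G : series X Y) :
  eqmod n F 0 -> smap F G n = tmap (F n) (G 0).
Proof.
move=> e; rewrite smap_lr scomp_leadl ?tmap_comp ?lcomp1l ?lcomp1r //.
by move=> i /e; rewrite /lwhisk => ->; exact: tmap0l.
Qed.

(** The monomial [f t^n], which is the correction made at each extension step. *)
Definition smono V W n (f : {linear V -> W}) : series V W :=
  fun i => if i == n then f else 0.

Lemma smonoE V W n (f : {linear V -> W}) : smono n f n = f.
Proof. by rewrite /smono eqxx. Qed.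

Lemma smono_eqmod0 V W n (f : {linear V -> W}) : eqmod n (smono n f) 0.
Proof. by move=> i lt_in; rewrite /smono ltn_eqF. Qed.

Lemma smono0 V W n (f : {linear V -> W}) : (0 < n)%N -> smono n f 0 = 0.
Proof. by rewrite /smono; case: n. Qed.

Lemma eqmod_addmono V W n (F : series V W) f : eqmod n (F + smono n f) F.
Proof. by move=> i lt_in; rewrite seriesDE smono_eqmod0 // addr0. Qed.

Lemma rwhisk_mono V W W' n (f : {linear W -> W'}) :
  rwhisk V (smono n f) = smono n (tmap (lid V) f).
Proof.
by apply/funext => i; rewrite /rwhisk /smono; case: eqP => // _; exact: tmap0r.
Qed.

Lemma lwhisk_mono V W W' n (f : {linear W -> W'}) :
  lwhisk V (smono n f) = smono n (tmap f (lid V)).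
Proof.
by apply/funext => i; rewrite /lwhisk /smono; case: eqP => // _; exact: tmap0l.
Qed.

(** The cross term of [f] and [g] lives in degree [2n], which exceeds [n] because [n] is positive;
    so the change in degree [n] is linear in the corrections. *)
Lemma scomp_addmono U V W n (F : series V W) (G : series U V) f g :
  (0 < n)%N ->
  ((F + smono n f) \oS (G + smono n g)) n
  = (F \oS G) n + (F 0 \oL g + f \oL G 0).
Proof.
move=> n_gt0; rewrite scompDr !scompDl !seriesDE.
rewrite (scomp_leadl G (@smono_eqmod0 _ _ n f)) smonoE.
rewrite !(scomp_leadr _ (@smono_eqmod0 _ _ n g)) smonoE smono0 // lcomp0l addr0.
by rewrite -addrA [f \oL _ + _]addrC.
Qed.

Lemma smap_addmono V W X Y n (F : series V W) (G : series X Y) f g :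
  (0 < n)%N ->
  smap (F + smono n f) (G + smono n g) n
  = smap F G n + (tmap (F 0) g + tmap f (G 0)).
Proof.
move=> n_gt0; rewrite !smap_lr rwhiskD rwhisk_mono.
have -> : lwhisk Y (F + smono n f) = lwhisk Y F + smono n (tmap f (lid Y)).
  by rewrite -lwhisk_mono; apply/funext => i; exact: tmapDl.
by rewrite scomp_addmono // !tmap_comp !lcomp1l !lcomp1r.
Qed.

(** Passage to the [t]-adic limit: since each step preserves the series modulo [t^n], the successive
    approximations stabilize in every degree, and locality of [P n] transfers it to the limit. *)
Lemma series_limit V W (P : nat -> series V W -> Prop) n0 F0 :
  (forall n F G, (n0 <= n)%N -> eqmod n F G -> P n F -> P n G) ->
  P n0 F0 ->
  (forall n F, (n0 <= n)%N -> P n F -> exists2 G, eqmod n G F & P n.+1 G) ->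
  exists2 F, eqmod n0 F F0 & forall n, (n0 <= n)%N -> P n F.
Proof.
move=> Ploc P0 Pstep.
(* The choice of successors must be total, so a pair that violates the hypotheses is sent to its own
   series. *)
have /choice[s Hs] (p : nat * series V W) : exists G, (n0 <= p.1)%N ->
    P p.1 p.2 -> eqmod p.1 G p.2 /\ P p.1.+1 G.
  have [[le0 Pp]|nP] := pselect ((n0 <= p.1)%N /\ P p.1 p.2).
    by have [G eG PG] := Pstep _ _ le0 Pp; exists G.
  by exists p.2 => le0 Pp; case: nP.
pose S := fix S k := if k is k'.+1 then s ((n0 + k')%N, S k') else F0.
have PS k : P (n0 + k)%N (S k).
  elim: k => [|k IH]; first by rewrite addn0.
  by rewrite addnS; apply: (Hs (_, _) _ IH).2; exact: leq_addr.
have eS k j : eqmod (n0 + k)%N (S (k + j)%N) (S k).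
  elim: j => [|j IH]; first by rewrite addn0.
  apply: eqmod_trans IH; rewrite addnS.
  apply: (@eqmod_leq _ _ _ (n0 + (k + j))).
    by rewrite addnA leq_addr.
  exact: (Hs (_, _) (leq_addr _ _) (PS _)).1.
(* The limit is read off the diagonal: coefficient [i] is final from stage [i.+1] on, as
   [i < n0 + i.+1]. *)
have eF k : eqmod (n0 + k)%N (fun i => S i.+1 i) (S k).
  move=> i lt_i; have [le_ik|/ltnW le_ki] := leqP i.+1 k.
    by rewrite -(subnKC le_ik) eS // addnS ltnS leq_addl.
  by rewrite -(subnKC le_ki) eS.
exists (fun i => S i.+1 i); first by have := eF 0; rewrite addn0.
move=> n /subnKC <-; apply: Ploc (PS _); first exact: leq_addr.
exact: eqmod_sym.
Qed.

End Truncation.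

(** * Obstruction cocycles *)

(** The common cancellation pattern of the obstruction identities: four differences of composites in
    which every composite occurs twice, with opposite signs. *)
Lemma subr_cross0 (V : zmodType) (a b c d : V) :
  (a - b) - (c - d) + (c - a) - (d - b) = 0.
Proof.
apply/eqP; rewrite subr_eq0 addrAC [_ + (c - a)]addrC addrA subrK.
by rewrite opprB addrC addrA subrK.
Qed.

(** * Failure of multiplicativity *)

Section Multiplicativity.
Variables (K : fieldType) (A B : lmodType K).
Variables (muA : {linear A ⊗ A -> A}) (muB : {linear B ⊗ B -> B}).
Implicit Type F : series A B.

(** Associativity is moved to [A ⊗ (A ⊗ A)], the bracketing chosen for [tpow]. *)
Lemma mulA_assocl : associative_mul muA ->
  muA \oL tmap muA (lid A) \oL assocl A A A = muA \oL tmap (lid A) muA.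
Proof.
move=> hA; apply: tens_ext3r => a b c.
have := hA ((a ⊗p b) ⊗p c).
by rewrite !lcompE !(tmapE, assoclE, assocrE).
Qed.

(** The target [B] is kept general in order to cover both deformations, with [B = H ⊗ A], and formal
    automorphisms, with [B = A]. *)
Definition mult_defect F : series (A ⊗ A) B :=
  F \oS sconst muA - sconst muB \oS smap F F.

Lemma mult_defect_eq0 n F :
  eqmod n (F \oS sconst muA) (sconst muB \oS smap F F) <->
  eqmod n (mult_defect F) 0.
Proof.
split=> [|e i lt_in]; first exact: eqmod_sub.
by apply/eqP; rewrite -subr_eq0; apply/eqP; exact: e.
Qed.

Lemma eqmod_mult_defect n F G :
  eqmod n F G -> eqmod n (mult_defect F) (mult_defect G).
Proof.
move=> e; apply: eqmodB; apply: eqmod_scomp => //; exact: eqmod_smap.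
Qed.

(** The subtracted term is the Hochschild coboundary of [f], with [A] acting on [B] from both sides
    through [F 0]. *)
Lemma mult_defect_addmono n F f : (0 < n)%N ->
  mult_defect (F + smono n f) n
  = mult_defect F n - (muB \oL tmap (F 0) f - f \oL muA + muB \oL tmap f (F 0)).
Proof.
move=> n_gt0; rewrite /mult_defect !seriesBE !sconst_scompE !scomp_sconstE.
rewrite smap_addmono // seriesDE smonoE lcompDl !lcompDr.
by rewrite opprD addrACA; congr (_ + _); rewrite addrAC opprB.
Qed.
End Multiplicativity.

Section MultiplicativityObstruction.
Variables (K : fieldType) (A B : lmodType K).
Variables (muA : {linear A ⊗ A -> A}) (muB : {linear B ⊗ B -> B}).
Hypotheses (hA : associative_mul muA) (hB : associative_mul muB).
Implicit Type F : series A B.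
Local Notation Q := (mult_defect muA muB).

(** Expanding [Q F] gives eight composites. Associativity of [muA] identifies the two that multiply
    three times in [A] or [B] before and after as [F ∘ muA ∘ muA], associativity of [muB] the two
    that apply [F] three times, and interchange matches the mixed ones. *)
Lemma mult_defect_series F :
  sconst muB \oS smap F (Q F)
  - Q F \oS sconst (tmap muA (lid A) \oL assocl A A A)
  + Q F \oS sconst (tmap (lid A) muA)
  - sconst muB \oS smap (Q F) F \oS sconst (assocl A A A) = 0.
Proof.
rewrite /mult_defect !smapBr !smapBl !scompBr !scompBl.
set x1 := sconst muB \oS smap F (F \oS _).
set x2 := sconst muB \oS smap F (_ \oS smap F F).
have -> : F \oS sconst muA \oS sconst (tmap muA (lid A) \oL assocl A A A)
        = F \oS sconst muA \oS sconst (tmap (lid A) muA).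
  by rewrite -!scompA !sconst_comp lcompA mulA_assocl.
have -> : sconst muB \oS smap F F \oS sconst (tmap (lid A) muA) = x1.
  rewrite -scompA.
  have -> : sconst (tmap (lid A) muA) = smap (sconst (lid A)) (sconst muA).
    by rewrite smap_lid1 rwhisk_sconst.
  by rewrite smap_comp scomp1r.
have -> : sconst muB \oS smap F F \oS sconst (tmap muA (lid A) \oL assocl A A A)
        = sconst muB \oS smap (F \oS sconst muA) F \oS sconst (assocl A A A).
  rewrite -sconst_comp -!scompA; congr (_ \oS _).
  rewrite scompA; congr (_ \oS _).
  rewrite -lwhisk_sconst !smap_rl lwhisk_comp.
  by rewrite -scompA.
have -> : sconst muB \oS smap (sconst muB \oS smap F F) F
          \oS sconst (assocl A A A) = x2.
  (* Writing [F] as [Id ∘ F] splits [muB ⊗ Id] off by interchange; naturality then moves the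
     associator to the left, where associativity of [muB] applies. *)
  rewrite -[F in smap (_ \oS _) F]scomp1l -smap_comp.
  rewrite -!scompA -sconst_assocl_smap.
  rewrite [smap (sconst _) _]smap_lr rwhisk_sconst lwhisk_sconst tmap1 scomp1r.
  rewrite !scompA !sconst_comp mulA_assocl // /x2.
  rewrite -[F in smap F (_ \oS _)]scomp1l -smap_comp smap_lid1 rwhisk_sconst.
  by rewrite scompA sconst_comp.
exact: subr_cross0.
Qed.

(** Coefficient of [t^n] in [mult_defect_series]: as the defect vanishes below degree [n], the
    series [F] enters only through [F 0]. *)
Lemma mult_defect_cocycle n F : eqmod n (Q F) 0 ->
  muB \oL tmap (F 0) (Q F n) - Q F n \oL (tmap muA (lid A) \oL assocl A A A)
  + Q F n \oL tmap (lid A) muA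
  - muB \oL tmap (Q F n) (F 0) \oL assocl A A A = 0.
Proof.
move=> e; have := congr1 (fun S => S n) (mult_defect_series F).
rewrite !(seriesDE, seriesNE) !(scomp_sconstE, sconst_scompE).
by rewrite smap_leadr // smap_leadl.
Qed.

End MultiplicativityObstruction.

(** * Associativity of the tensor product of two algebras *)

Section TensorAlgebra.
Variable K : fieldType.

Lemma alg_mulA (H : algType K) : associative_mul (alg_mul H).
Proof.
move=> x; congr (GRing.Linear.sort _ x); apply: tens_ext3l => a b c.
rewrite !lcompE !(tmapE, assocrE, lidE, alg_mulE); exact: esym (mulrA _ _ _).
Qed.

Lemma tens_mulE (B A : lmodType K) (muB : {linear B ⊗ B -> B})
  (muA : {linear A ⊗ A -> A}) x a y b :
  tens_mul muB muA ((x ⊗p a) ⊗p (y ⊗p b)) = muB (x ⊗p y) ⊗p muA (a ⊗p b).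
Proof. by rewrite lcompE midtwistE tmapE. Qed.

Lemma tens_mulA (B A : lmodType K) (muB : {linear B ⊗ B -> B})
  (muA : {linear A ⊗ A -> A}) :
  associative_mul muB -> associative_mul muA ->
  associative_mul (tens_mul muB muA).
Proof.
move=> hB hA.
(* [tens_mul] is generalized because rewriting would unfold it *)
move: (tens_mul muB muA) (@tens_mulE _ _ muB muA) => T TE x.
set f := _ \oL tmap _ _; set g := _ \oL assocr _ _ _.
suff -> : f = g by []; apply: tens_ext3l => u v w.
(* Each argument is itself a tensor. Freezing the other two makes both sides linear in it, so
   [tens_ext] reduces it to a pure tensor; the same is done for [v] and [w]. *)
suff e : f \oL rpure _ w \oL rpure _ v = g \oL rpure _ w \oL rpure _ v.
  exact: (congr1 (fun h : {linear (B ⊗ A) -> (B ⊗ A)} => h u) e).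
apply: tens_ext => {u} u1 u2; rewrite !lcompE /=; set u := u1 ⊗p u2.
suff e : f \oL rpure _ w \oL lpure _ u = g \oL rpure _ w \oL lpure _ u.
  exact: (congr1 (fun h : {linear (B ⊗ A) -> (B ⊗ A)} => h v) e).
apply: tens_ext => {v} v1 v2; rewrite !lcompE /=; set v := v1 ⊗p v2.
suff e : f \oL lpure _ (u ⊗p v) = g \oL lpure _ (u ⊗p v).
  exact: (congr1 (fun h : {linear (B ⊗ A) -> (B ⊗ A)} => h w) e).
apply: tens_ext => {w} w1 w2.
have := hA ((u2 ⊗p v2) ⊗p w2); have := hB ((u1 ⊗p v1) ⊗p w1).
rewrite !lcompE !(tmapE, assocrE, lidE) => eB eA.
by rewrite !TE eB eA.
Qed.

End TensorAlgebra.

(** * Coproduct and product of [H] against power series *)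

Section ComoduleSeries.
Variables (K : fieldType) (H : algType K) (Delta : {linear H -> H ⊗ H}).
Implicit Types V W X : lmodType K.

(** This is [comul_at] in position 0, for arbitrary [X]: the differential in degree two uses it with
    both [A] and [H ⊗ A]. *)
Definition comul_left X : {linear H ⊗ X -> H ⊗ (H ⊗ X)} :=
  assocr H H X \oL tmap Delta (lid X).

Lemma comul_leftA X :
  tmap Delta (lid H) \oL Delta
  =1 assocl H H H \oL tmap (lid H) Delta \oL Delta ->
  comul_left (H ⊗ X)%type \oL comul_left X
  = tmap (lid H) (comul_left X) \oL comul_left X.
Proof.
move=> hD; apply: tens_ext => h x.
(* [J] rebrackets a triple tensor and attaches the fixed [x] at the end; both sides are [J] applied
   to an iterated coproduct of [h], so coassociativity of [Delta] suffices. *)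
pose J : {linear (H ⊗ H) ⊗ H -> H ⊗ (H ⊗ (H ⊗ X))} :=
  tmap (lid H) (tmap (lid H) (rpure H x)) \oL assocr H H H.
have eJ1 b : assocr H H (H ⊗ X)%type \oL rpure _ (b ⊗p x) = J \oL rpure _ b.
  by apply: tens_ext => a1 a2; rewrite !lcompE /rpure !assocrE !tmapE.
have eJ2 a : tmap (lid H) (assocr H H X) \oL lpure _ a \oL rpure _ x
           = J \oL assocl H H H \oL lpure _ a.
  apply: tens_ext => b1 b2; rewrite !lcompE /rpure /lpure.
  by rewrite assoclE assocrE !tmapE assocrE.
have e1 : comul_left (H ⊗ X)%type \oL assocr H H X \oL rpure _ x
        = J \oL tmap Delta (lid H).
  apply: tens_ext => a b; rewrite !lcompE /rpure assocrE !tmapE !lidE.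
  exact: (congr1 (fun f : {linear _ -> _} => f (Delta a)) (eJ1 b)).
have e2 : tmap (lid H) (comul_left X) \oL assocr H H X \oL rpure _ x
        = J \oL assocl H H H \oL tmap (lid H) Delta.
  apply: tens_ext => a b; rewrite !lcompE /rpure assocrE !tmapE !lidE.
  rewrite [comul_left X _]lcompE tmapE lidE.
  have := congr1 (fun f : {linear _ -> _} => f (Delta b)) (eJ2 a).
  by rewrite !lcompE /lpure /rpure tmapE.
transitivity (J ((tmap Delta (lid H) \oL Delta) h)); last rewrite hD.
  have := congr1 (fun f : {linear _ -> _} => f (Delta h)) e1.
  by rewrite /comul_left !lcompE tmapE.
have := congr1 (fun f : {linear _ -> _} => f (Delta h)) e2.
by rewrite /comul_left !lcompE tmapE => ->.
Qed.

(** The coproduct and the series act on different tensor factors. *)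
Lemma sconst_comul_left_rwhisk W X (F : series W X) :
  sconst (comul_left X) \oS rwhisk H F
  = rwhisk H (rwhisk H F) \oS sconst (comul_left W).
Proof.
apply/funext => n; rewrite sconst_scompE scomp_sconstE /rwhisk /comul_left.
by rewrite -lcompA tmap_comp lcomp1l lcomp1r -{1}[Delta]lcomp1l
  -{1}[F n]lcomp1r -tmap_comp !lcompA -tmap1 assocr_nat.
Qed.

(** The middle twist is natural, and the product of [H] commutes with maps on the [A] factor. The
    truncated form is needed because in the proof of rigidity [Phi] is multiplicative only up to
    some degree. *)
Lemma rwhisk_tens_mul (A : lmodType K) (mu : {linear A ⊗ A -> A})
    (Phi : series A A) n :
  eqmod n (Phi \oS sconst mu) (sconst mu \oS smap Phi Phi) ->
  eqmod n (rwhisk H Phi \oS sconst (tens_mul (alg_mul H) mu))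
    (sconst (tens_mul (alg_mul H) mu) \oS smap (rwhisk H Phi) (rwhisk H Phi)).
Proof.
move=> e; rewrite -sconst_comp -scompA sconst_midtwist_smap !scompA.
apply: eqmod_scomp => //.
have -> : tmap (alg_mul H) mu = tmap (alg_mul H) (lid A) \oL tmap (lid _) mu.
  by rewrite tmap_comp lcomp1l lcomp1r.
rewrite -sconst_comp -rwhisk_sconst -lwhisk_sconst scompA.
rewrite -smap_rl smap_lr -!scompA -!rwhisk_comp.
by apply: eqmod_scomp => //; exact: eqmod_rwhisk.
Qed.

End ComoduleSeries.

(** * Failure of coassociativity and of trivialization *)

Section Coassociativity.
Variables (K : fieldType) (H : algType K) (Delta : {linear H -> H ⊗ H}).
Hypothesis hDelta : tmap Delta (lid H) \oL Delta
  =1 assocl H H H \oL tmap (lid H) Delta \oL Delta.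
Variable A : lmodType K.
Implicit Types (R : series A (H ⊗ A)) (rho : {linear A -> H ⊗ A}).

(** The sign is such that, as for [mult_defect], adding [f t^n] to [R] subtracts a coboundary of
    [f]. *)
Definition coassoc_defect R : series A (H ⊗ (H ⊗ A)) :=
  sconst (comul_left Delta A) \oS R - rwhisk H R \oS R.

Lemma eqmod_coassoc_defect n R R' :
  eqmod n R R' -> eqmod n (coassoc_defect R) (coassoc_defect R').
Proof.
by move=> e; apply: eqmodB; apply: eqmod_scomp => //; exact: eqmod_rwhisk.
Qed.

(** Of the eight composites, coassociativity of [Delta] identifies the two with two coproducts and
    one [R]; naturality of [comul_left] and functoriality of whiskering pair the others. *)
Lemma coassoc_defect_series R :
  rwhisk H (rwhisk H R) \oS coassoc_defect R
  - sconst (tmap (lid H) (comul_left Delta A)) \oS coassoc_defect R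
  + sconst (comul_left Delta (H ⊗ A)%type) \oS coassoc_defect R
  - rwhisk H (coassoc_defect R) \oS R = 0.
Proof.
rewrite /coassoc_defect rwhiskB !scompBr scompBl !rwhisk_comp rwhisk_sconst.
rewrite !scompA !sconst_comp comul_leftA // sconst_comul_left_rwhisk.
exact: subr_cross0.
Qed.

Lemma coassoc_defect_cocycle n R : eqmod n (coassoc_defect R) 0 ->
  tmap (lid H) (tmap (lid H) (R 0)) \oL coassoc_defect R n
  - tmap (lid H) (comul_left Delta A) \oL coassoc_defect R n
  + comul_left Delta (H ⊗ A)%type \oL coassoc_defect R n
  - tmap (lid H) (coassoc_defect R n) \oL R 0 = 0.
Proof.
move=> e; have := congr1 (fun S => S n) (coassoc_defect_series R).
rewrite !(seriesDE, seriesNE) !sconst_scompE scomp_leadr // scomp_leadl //.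
by move=> i /e; rewrite /rwhisk => ->; exact: tmap0r.
Qed.

Lemma coassoc_defect_addmono n R f : (0 < n)%N ->
  coassoc_defect (R + smono n f) n
  = coassoc_defect R n - (tmap (lid H) (R 0) \oL f
    - comul_left Delta A \oL f + tmap (lid H) f \oL R 0).
Proof.
move=> n_gt0; rewrite /coassoc_defect !seriesBE !sconst_scompE.
rewrite rwhiskD rwhisk_mono scomp_addmono // seriesDE smonoE lcompDr.
by rewrite opprD addrACA; congr (_ + _); rewrite addrAC opprB.
Qed.

Variables (mu : {linear A ⊗ A -> A}) (rho : {linear A -> H ⊗ A}).

(* An automorphism [Phi] for which this vanishes makes [R] equivalent to the
   constant deformation [rho]. *)
Definition trivial_defect R (Phi : series A A) : series A (H ⊗ A) :=
  R \oS Phi - rwhisk H Phi \oS sconst rho.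

Lemma eqmod_trivial_defect n R (Phi Psi : series A A) : eqmod n Phi Psi ->
  eqmod n (trivial_defect R Phi) (trivial_defect R Psi).
Proof.
by move=> e; apply: eqmodB; apply: eqmod_scomp => //; exact: eqmod_rwhisk.
Qed.

(** Put [X = R ∘ Phi] and [Y = (Id ⊗ Phi) ∘ rho]. Then [(Id ⊗ R) ∘ X = Δ ∘ X],
    [(Id ⊗ X) ∘ rho = (Id ⊗ R) ∘ Y] and [(Id ⊗ Y) ∘ rho = Δ ∘ Y], so the alternating sum formed with
    [X - Y] cancels; its coefficient of [t^n] is the claim. *)
Lemma trivial_defect_coassoc n R (Phi : series A A) :
  R 0 = rho ->
  tmap (lid H) rho \oL rho = comul_left Delta A \oL rho ->
  coassoc_defect R = 0 -> eqmod n (trivial_defect R Phi) 0 ->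
  let E := trivial_defect R Phi n in
  tmap (lid H) rho \oL E - comul_left Delta A \oL E + tmap (lid H) E \oL rho = 0.
Proof.
move=> R0 hrho /eqP; rewrite subr_eq0 => /eqP hR e E.
have : rwhisk H R \oS trivial_defect R Phi
     - sconst (comul_left Delta A) \oS trivial_defect R Phi
     + rwhisk H (trivial_defect R Phi) \oS sconst rho = 0.
  rewrite /trivial_defect rwhiskB !scompBr scompBl.
  have -> : rwhisk H (R \oS Phi) \oS sconst rho
          = rwhisk H R \oS (rwhisk H Phi \oS sconst rho).
    by rewrite rwhisk_comp scompA.
  have -> : rwhisk H (rwhisk H Phi \oS sconst rho) \oS sconst rho
          = sconst (comul_left Delta A) \oS (rwhisk H Phi \oS sconst rho).
    rewrite rwhisk_comp rwhisk_sconst -scompA sconst_comp hrho -sconst_comp.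
    by rewrite !scompA sconst_comul_left_rwhisk.
  rewrite (scompA (sconst _) R) hR -scompA.
  have := subr_cross0 (rwhisk H R \oS (R \oS Phi))
    (rwhisk H R \oS (rwhisk H Phi \oS sconst rho)) (rwhisk H R \oS (R \oS Phi))
    (sconst (comul_left Delta A) \oS (rwhisk H Phi \oS sconst rho)).
  by rewrite subrr addr0 => <-; congr (_ + _); rewrite opprB.
move/(congr1 (fun S => S n)).
rewrite !(seriesDE, seriesNE) sconst_scompE scomp_sconstE scomp_leadr //.
by rewrite /rwhisk R0.
Qed.

(** The leading coefficient of the difference of two multiplicative series that agree modulo [t^n]
    satisfies the Leibniz rule. Here [Phi] has to be multiplicative in degree [n] too, hence
    [n.+1]. *)
Lemma trivial_defect_mult n R (Phi : series A A) :
  Phi 0 = lid A -> R 0 = rho ->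
  rho \oL mu = tens_mul (alg_mul H) mu \oL tmap rho rho ->
  mult_defect mu (tens_mul (alg_mul H) mu) R = 0 ->
  eqmod n.+1 (Phi \oS sconst mu) (sconst mu \oS smap Phi Phi) ->
  eqmod n (trivial_defect R Phi) 0 ->
  let E := trivial_defect R Phi n in let M := tens_mul (alg_mul H) mu in
  M \oL tmap rho E - E \oL mu + M \oL tmap E rho = 0.
Proof.
move=> Phi0 R0 hrho /eqP; rewrite subr_eq0 => /eqP hR hPhi e E M.
set X := R \oS Phi; set Y := rwhisk H Phi \oS sconst rho.
have eX : eqmod n.+1 (X \oS sconst mu) (sconst M \oS smap X X).
  rewrite -smap_comp scompA -hR -!scompA; exact: eqmod_scomp.
have eY : eqmod n.+1 (Y \oS sconst mu) (sconst M \oS smap Y Y).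
  rewrite -scompA sconst_comp hrho -sconst_comp scompA -smap_comp.
  have -> : sconst (tmap rho rho) = smap (sconst rho) (sconst rho).
    rewrite smap_lr lwhisk_sconst rwhisk_sconst sconst_comp tmap_comp.
    by rewrite lcomp1l lcomp1r.
  rewrite scompA; apply: eqmod_scomp => //; exact: rwhisk_tens_mul.
(* The splitting [X ⊗ X - Y ⊗ Y = X ⊗ (X - Y) + (X - Y) ⊗ Y] isolates the factor [X - Y], which
   starts in degree [n]. *)
have : (trivial_defect R Phi \oS sconst mu) n
     = (sconst M \oS (smap X (X - Y) + smap (X - Y) Y)) n.
  rewrite smapBr smapBl addrA subrK scompBr scompBl !seriesBE.
  by rewrite eX ?eY.
rewrite scomp_sconstE sconst_scompE seriesDE smap_leadr // smap_leadl //.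
rewrite -/(trivial_defect R Phi) -/E lcompDr.
have -> : X 0 = rho by rewrite /X scompE0 Phi0 R0 lcomp1r.
have -> : Y 0 = rho by rewrite /Y scomp_sconstE /rwhisk Phi0 tmap1 lcomp1l.
by move=> ->; rewrite opprD addrA subrr add0r addNr.
Qed.

Lemma trivial_defect_addmono n R (Phi : series A A) f : (0 < n)%N ->
  trivial_defect R (Phi + smono n f) n
  = trivial_defect R Phi n + (R 0 \oL f - tmap (lid H) f \oL rho).
Proof.
move=> n_gt0; rewrite /trivial_defect !seriesBE rwhiskD rwhisk_mono.
rewrite scompDr scompDl !seriesDE !scomp_sconstE smonoE.
rewrite (scomp_leadr _ (@smono_eqmod0 _ _ _ n f)) smonoE.
by rewrite opprD addrACA.
Qed.

End Coassociativity.

(** * Deformations *)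

Section Inverse.
Variables (K : fieldType) (A : lmodType K).

Lemma series_left_inverse (Phi : series A A) : Phi 0 = lid A ->
  exists2 Psi : series A A, Psi 0 = lid A & Psi \oS Phi = sconst (lid A).
Proof.
move=> Phi0.
have [||n F n_gt0 eF|Psi e1 ePsi] :=
  @series_limit K A A (fun n Psi => eqmod n (Psi \oS Phi) (sconst (lid A)))
    1 (sconst (lid A)).
- move=> n F G _ e; apply: eqmod_trans.
  by apply: eqmod_scomp => //; exact: eqmod_sym.
- by move=> [|//] _; rewrite scomp1l Phi0.
(* As [Phi 0] is the identity, adding [f t^n] to [F] adds exactly [f] to the coefficient of [t^n],
   which has to become 0. *)
- exists (F + smono n (- (F \oS Phi) n)); first exact: eqmod_addmono.
  apply: eqmodS.
    by apply: eqmod_trans eF; apply: eqmod_scomp => //; exact: eqmod_addmono.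
  rewrite scompDl seriesDE (scomp_leadl _ (@smono_eqmod0 _ _ _ _ _)) smonoE.
  by rewrite Phi0 lcomp1r subrr; case: n n_gt0 {eF}.
by exists Psi; [exact: e1 | exact: eqmod_all ePsi].
Qed.

(** The left inverse [Psi] has a left inverse [Xi] of its own, and [Xi = Xi ∘ Psi ∘ Phi = Phi], so
    [Psi] is two-sided. *)
Lemma series_inverse (Phi : series A A) : Phi 0 = lid A ->
  exists Psi : series A A, is_series_inverse Phi Psi.
Proof.
move=> /series_left_inverse[Psi /series_left_inverse[Xi _ eXi] ePsi].
exists Psi; split=> n; first by rewrite ePsi.
have -> : Phi = Xi by rewrite -[Phi]scomp1l -eXi -scompA ePsi scomp1r.
by rewrite eXi.
Qed.

End Inverse.

(** * Differentials in low degrees, in the form produced by the defects *)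

Section LowDegrees.
Variables (K : fieldType) (H : algType K) (Delta : {linear H -> H ⊗ H}).
Variables (A : lmodType K) (mu : {linear A ⊗ A -> A}) (rho : {linear A -> H ⊗ A}).

Lemma dca0_1E (f : {linear A -> H ⊗ A}) :
  @dca0 K H Delta A rho 1 f
  = tmap (lid H) rho \oL f - comul_left Delta A \oL f + tmap (lid H) f \oL rho.
Proof. by rewrite /dca0 big_nat1 expr1 scaleN1r sqrrN expr1n scale1r. Qed.

Lemma dca0_2E (f : {linear A -> H ⊗ (H ⊗ A)}) :
  @dca0 K H Delta A rho 2 f
  = tmap (lid H) (tmap (lid H) rho) \oL f
    - tmap (lid H) (comul_left Delta A) \oL f
    + comul_left Delta (H ⊗ A)%type \oL f - tmap (lid H) f \oL rho.
Proof.
rewrite /dca0 big_nat_recr //= big_nat1 expr1 scaleN1r sqrrN expr1n scale1r.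
by rewrite -signr_odd /= expr1 scaleN1r addrA.
Qed.

Lemma dca1_0E (f : {linear A -> H ⊗ A}) :
  @dca1 K H A mu rho 0 f
  = tens_mul (alg_mul H) mu \oL tmap rho f - f \oL mu
    + tens_mul (alg_mul H) mu \oL tmap f rho.
Proof.
by rewrite /dca1 big_nat1 expr1 scaleN1r sqrrN expr1n scale1r lcomp1r.
Qed.

Lemma dca1_1E (f : {linear A ⊗ A -> H ⊗ A}) :
  @dca1 K H A mu rho 1 f
  = tens_mul (alg_mul H) mu \oL tmap rho f
    - f \oL (tmap mu (lid A) \oL assocl A A A) + f \oL tmap (lid A) mu
    - tens_mul (alg_mul H) mu \oL tmap f rho \oL assocl A A A.
Proof.
rewrite /dca1 big_nat_recr //= big_nat1 expr1 scaleN1r sqrrN expr1n scale1r.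
by rewrite -signr_odd /= expr1 scaleN1r addrA tmap1 lcomp1r.
Qed.

Lemma dhS_0E (f : {linear A -> A}) :
  @dhS K A mu 0 f
  = mu \oL tmap (lid A) f - f \oL mu + mu \oL tmap f (lid A).
Proof.
by rewrite /dhS big_nat1 expr1 scaleN1r sqrrN expr1n scale1r lcomp1r.
Qed.

Lemma dhS_1E (f : {linear A ⊗ A -> A}) :
  @dhS K A mu 1 f
  = mu \oL tmap (lid A) f
    - f \oL (tmap mu (lid A) \oL assocl A A A) + f \oL tmap (lid A) mu
    - mu \oL tmap f (lid A) \oL assocl A A A.
Proof.
rewrite /dhS big_nat_recr //= big_nat1 expr1 scaleN1r sqrrN expr1n scale1r.
by rewrite -signr_odd /= expr1 scaleN1r addrA tmap1 lcomp1r.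
Qed.

(** The Leibniz rule without elements, ready to cancel the correction term of
    [mult_defect_addmono]. *)
Lemma is_derivationE (phi : {linear A -> A}) : is_derivation mu phi <->
  phi \oL mu = mu \oL tmap (lid A) phi + mu \oL tmap phi (lid A).
Proof.
split=> [d|e a b].
  by apply: tens_ext => a b; rewrite homDE !lcompE !tmapE d addrC.
have := congr1 (fun f : {linear _ -> _} => f (a ⊗p b)) e.
by rewrite homDE !lcompE !tmapE addrC.
Qed.

End LowDegrees.

(** * Infinitesimals, integrability and rigidity *)

Section Deformations.
Variables (K : fieldType) (H : algType K) (Delta : {linear H -> H ⊗ H}).
Variables (eps : {linear H -> K^o}) (A : lmodType K) (mu : {linear A ⊗ A -> A}).
Variable rho : {linear A -> H ⊗ A}.
Hypothesis hH : is_bialgebra Delta eps.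
Hypothesis hA : associative_mul mu.
Hypothesis hrho : is_comodule_algebra Delta eps mu rho.
Local Notation M := (tens_mul (alg_mul H) mu).
Implicit Type R : series A (H ⊗ A).

Lemma is_deformationE R : is_deformation Delta mu rho R <->
  [/\ R 0 = rho, coassoc_defect Delta R = 0 & mult_defect mu M R = 0].
Proof.
split=> [[R0 eA eM]|[R0 /eqP eA /eqP eM]]; split=> //.
- apply/eqP; rewrite subr_eq0; apply/eqP/funext => n.
  by rewrite -eA smap_lid1.
- by apply/eqP; rewrite subr_eq0; apply/eqP/funext.
- by move=> n; rewrite smap_lid1; move: eA; rewrite subr_eq0 => /eqP <-.
- by move=> n; move: eM; rewrite subr_eq0 => /eqP <-.
Qed.

Lemma coact_lcompA : tmap (lid H) rho \oL rho = comul_left Delta A \oL rho.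
Proof.
by apply: linear_ext => a; exact: (coactA (coact_comodule hrho)).
Qed.

Lemma coact_lcompM : rho \oL mu = M \oL tmap rho rho.
Proof. by apply: linear_ext => a; exact: (coactM hrho). Qed.

Lemma trivial_deformation : is_deformation Delta mu rho (sconst rho).
Proof.
apply/is_deformationE; split=> //; apply/eqP; rewrite subr_eq0; apply/eqP.
  by rewrite rwhisk_sconst !sconst_comp coact_lcompA.
rewrite smap_lr lwhisk_sconst rwhisk_sconst !sconst_comp tmap_comp.
by rewrite lcomp1l lcomp1r coact_lcompM.
Qed.

(** In degree one every product pairs [rho] with the infinitesimal, so the coefficients of [t] in
    the two deformation equations are the two components of the differential, up to sign. *)
Lemma infinitesimal_cocycle R : is_deformation Delta mu rho R ->
  is_cocycle (dca Delta mu rho) 1 (infinitesimal R).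
Proof.
move=> /is_deformationE[R0 eA eM]; congr pair.
  rewrite dca0_1E; have := congr1 (fun S => - S 1%N) eA.
  rewrite /coassoc_defect seriesBE sconst_scompE scompE1 /rwhisk R0 opprB oppr0.
  by rewrite addrAC.
rewrite dca1_0E; have := congr1 (fun S => - S 1%N) eM.
rewrite /mult_defect seriesBE sconst_scompE scomp_sconstE opprB oppr0 => <-.
by rewrite /smap big_ord_recr big_ord1 lcompDr /= R0 addrAC.
Qed.

(** The coefficient of [t] in the equivalence reads [R' 1 = R 1 + rho ∘ Phi 1 - (Id ⊗ Phi 1) ∘ rho],
    and [Phi 1] is a derivation by the coefficient of [t] in multiplicativity. *)
Lemma equivalent_cohomologous R R' :
  is_deformation Delta mu rho R -> is_deformation Delta mu rho R' ->
  equivalent mu R R' ->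
  cohomologous (dca Delta mu rho) 1 (infinitesimal R) (infinitesimal R').
Proof.
move=> [R0 _ _] _ [Phi [Psi [[Phi0 PhiM] [ePsi _] eR']]].
have Psi0 : Psi 0 = lid A by have := ePsi 0; rewrite scompE0 Phi0 lcomp1r.
have Psi1 : Psi 1 = - Phi 1.
  have := ePsi 1; rewrite scompE1 Psi0 Phi0 lcomp1r lcomp1l => /eqP.
  by rewrite addrC addr_eq0 => /eqP.
have dPhi : Phi 1 \in derivation_pred mu.
  apply/asboolP/is_derivationE.
  have := PhiM 1; rewrite scomp_sconstE sconst_scompE => ->.
  by rewrite /smap big_ord_recr big_ord1 /= Phi0 lcompDr.
(* The minus sign appears because the coboundary has to equal [R 1 - R' 1]. *)
have dN : - Phi 1 \in derivation_pred mu by rewrite rpredN.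
exists (MkDer dN); rewrite /infinitesimal eR' smap_lid1 /=.
rewrite scompE1 scompE0 scompE1 /rwhisk Psi0 Psi1 Phi0 R0 tmap1.
rewrite !lcomp1r !lcomp1l.
rewrite /dca_der /= lcompNr [X in _ - X]addrC.
by rewrite opprD opprD addrA addrA subrr add0r addrC.
Qed.

Definition deformation_mod n R : Prop :=
  [/\ R 0 = rho, eqmod n (coassoc_defect Delta R) 0 &
      eqmod n (mult_defect mu M R) 0].

Lemma deformation_mod_addmono n R f : (0 < n)%N ->
  (coassoc_defect Delta R n, mult_defect mu M R n) = dca Delta mu rho 1 f ->
  deformation_mod n R -> deformation_mod n.+1 (R + smono n f).
Proof.
move=> n_gt0 e [R0 cR mR].
have eA : coassoc_defect Delta R n
        = dca0 Delta rho (f : {linear A -> htpow H A 1}).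
  exact: (congr1 (@fst {linear A -> H ⊗ (H ⊗ A)} {linear A ⊗ A -> H ⊗ A}) e).
have eM : mult_defect mu M R n = dca1 mu rho (f : {linear tpow A 1 -> _}).
  exact: (congr1 (@snd {linear A -> H ⊗ (H ⊗ A)} {linear A ⊗ A -> H ⊗ A}) e).
split.
- by rewrite seriesDE smono0 // addr0.
- apply: eqmodS.
    apply: eqmod_trans cR; exact/eqmod_coassoc_defect/eqmod_addmono.
  by rewrite coassoc_defect_addmono // eA dca0_1E R0 subrr.
apply: eqmodS.
  apply: eqmod_trans mR; exact/eqmod_mult_defect/eqmod_addmono.
by rewrite mult_defect_addmono // eM dca1_0E R0 subrr.
Qed.

Lemma deformation_mod_extend n R : cohomology_trivial (dca Delta mu rho) 2 ->
  (0 < n)%N -> deformation_mod n R ->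
  exists f, deformation_mod n.+1 (R + smono n f).
Proof.
move=> H2 n_gt0 dR; have [R0 cR mR] := dR.
have [|f] := H2 (coassoc_defect Delta R n, mult_defect mu M R n).
  congr pair => /=.
    by rewrite dca0_2E -R0 coassoc_defect_cocycle //; exact: comulA hH.
  rewrite dca1_1E -R0 mult_defect_cocycle //.
  exact: tens_mulA (@alg_mulA _ H) hA.
by rewrite subr0 => ef; exists f; exact: deformation_mod_addmono.
Qed.

Lemma cocycle_integrable : cohomology_trivial (dca Delta mu rho) 2 ->
  forall f : Fca H mu 1, is_cocycle (dca Delta mu rho) 1 f ->
  exists R : series A (H ⊗ A),
    is_deformation Delta mu rho R /\ infinitesimal R = f.
Proof.
move=> H2 f df.
(* The iteration starts modulo [t^2], so that the limit keeps the prescribed coefficient [f] of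
   [t]. *)
have [||n R n_gt1 dR|R eR dR] := @series_limit K A (H ⊗ A)%type
    deformation_mod 2 (sconst rho + smono 1 f).
- move=> n F G n_gt1 e [F0 cF mF]; split; first by rewrite -e // ltnW.
    apply: eqmod_trans cF; exact/eqmod_coassoc_defect/eqmod_sym.
  apply: eqmod_trans mF; exact/eqmod_mult_defect/eqmod_sym.
- have [_ eA eM] := (is_deformationE _).1 trivial_deformation.
  (* The constant deformation has no defect, so the condition on [f] is exactly that it is a
     cocycle. *)
  apply: deformation_mod_addmono => //; last by split; rewrite ?eA ?eM.
  by rewrite eA eM df.
- have [g dg] := deformation_mod_extend H2 (ltnW n_gt1) dR.
  by exists (R + smono n g); first exact: eqmod_addmono.
exists R; split; last first.
  by rewrite /infinitesimal eR // seriesDE smonoE add0r.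
apply/is_deformationE; split; first by have [] := dR 2 isT.
  by apply: (@eqmod_all _ _ _ 2) => n /dR[].
by apply: (@eqmod_all _ _ _ 2) => n /dR[].
Qed.

Definition trivialization_mod R n (Phi : series A A) : Prop :=
  [/\ Phi 0 = lid A, eqmod n (mult_defect mu mu Phi) 0 &
      eqmod n (trivial_defect rho R Phi) 0].

Lemma trivialization_mod_extend R n Phi :
  cohomology_trivial (dh mu) 2 -> cohomology_trivial (dca Delta mu rho) 1 ->
  is_deformation Delta mu rho R -> (0 < n)%N -> trivialization_mod R n Phi ->
  exists2 Phi', eqmod n Phi' Phi & trivialization_mod R n.+1 Phi'.
Proof.
move=> H2 H1 /is_deformationE[R0 cR mR] n_gt0 [Phi0 mPhi tPhi].
have [|g] := H2 (mult_defect mu mu Phi n).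
  by have := mult_defect_cocycle hA hA mPhi; rewrite /is_cocycle /= dhS_1E Phi0.
rewrite subr0 [dh _ _ _]dhS_0E => eg.
(* First correction: [g] removes the multiplicative defect in degree [n], which makes the next
   failure of triviality a cocycle. *)
pose Phi1 := Phi + smono n g.
have e1 : eqmod n Phi1 Phi by exact: eqmod_addmono.
have Phi10 : Phi1 0 = lid A by rewrite e1.
have mPhi1 : eqmod n.+1 (mult_defect mu mu Phi1) 0.
  apply: eqmodS; first by apply: eqmod_trans mPhi; exact: eqmod_mult_defect.
  by rewrite mult_defect_addmono // Phi0 eg subrr.
have tPhi1 : eqmod n (trivial_defect rho R Phi1) 0.
  by apply: eqmod_trans tPhi; exact: eqmod_trivial_defect.
have [|d] := H1 (trivial_defect rho R Phi1 n).
  congr pair.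
    rewrite dca0_1E; apply: trivial_defect_coassoc => //; exact: coact_lcompA.
  rewrite dca1_0E; apply: trivial_defect_mult => //; first exact: coact_lcompM.
  exact/mult_defect_eq0.
rewrite subr0 => ed.
(* Second correction: [d] bounds the remaining defect, and subtracting it in degree [n] keeps the
   multiplicativity just obtained because a derivation is a Hochschild cocycle. *)
have dd : - der_val d \in derivation_pred mu by rewrite rpredN der_valP.
have e2 : eqmod n (Phi1 + smono n (- der_val d)) Phi1 by exact: eqmod_addmono.
exists (Phi1 + smono n (- der_val d)); first exact: eqmod_trans e1.
split; first by rewrite e2.
  apply: eqmodS.
    apply: eqmod_trans (eqmod_leq (leqnSn n) mPhi1); exact: eqmod_mult_defect.
  rewrite mult_defect_addmono // mPhi1 // Phi10.
  move/asboolP/is_derivationE: dd => ->.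
  by rewrite [X in _ - X]addrAC subrr subr0.
apply: eqmodS; first by apply: eqmod_trans tPhi1; exact: eqmod_trivial_defect.
rewrite trivial_defect_addmono // ed R0 /= /dca_der lcompNr.
have -> : tmap (lid H) (- der_val d) \oL rho
        = - (tmap (lid H) (der_val d) \oL rho).
  by rewrite tmapNr; exact: linear_ext.
by rewrite -opprD subrr.
Qed.

Lemma rigidity : cohomology_trivial (dh mu) 2 ->
  cohomology_trivial (dca Delta mu rho) 1 -> rigid Delta mu rho.
Proof.
move=> H2 H1 R dR; have [R0 cR mR] := (is_deformationE R).1 dR.
have [||n Phi n_gt0|Phi e1 tPhi] := @series_limit K A A
    (trivialization_mod R) 1 (sconst (lid A)).
- move=> n F G n_gt0 e [F0 mF tF]; split; first by rewrite -e.
    apply: eqmod_trans mF; exact/eqmod_mult_defect/eqmod_sym.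
  apply: eqmod_trans tF; exact/eqmod_trivial_defect/eqmod_sym.
(* Modulo [t] the identity works, because [R 0 = rho]. *)
- split=> // -[|//] _.
    rewrite /mult_defect seriesBE scomp1l sconst_scompE /smap big_ord1 /=.
    by rewrite tmap1 lcomp1r subrr.
  by rewrite /trivial_defect seriesBE scomp1r rwhisk_sconst tmap1 scomp1l R0 subrr.
- exact: trivialization_mod_extend.
have [Psi iPsi] := series_inverse (e1 0 isT); exists Phi, Psi.
have /eqP mPhi : mult_defect mu mu Phi = 0.
  by apply: (@eqmod_all _ _ _ 1) => n /tPhi[].
have /eqP : trivial_defect rho R Phi = 0.
  by apply: (@eqmod_all _ _ _ 1) => n /tPhi[].
rewrite subr_eq0 => /eqP ePhi; split=> //.
  split; first exact: e1.
  by move: mPhi; rewrite subr_eq0 => /eqP <-.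
(* Composing [R ∘ Phi = (Id ⊗ Phi) ∘ rho] on the left with [Id ⊗ Psi] leaves [rho]. *)
move=> n; rewrite smap_lid1 -scompA ePhi scompA -rwhisk_comp.
have -> : Psi \oS Phi = sconst (lid A) by apply/funext; exact: iPsi.1.
by rewrite rwhisk_sconst tmap1 scomp1l.
Qed.

End Deformations.

Theorem mainTheorem11 (K : fieldType)
  (H : algType K) (Delta : {linear H -> H ⊗ H}) (eps : {linear H -> K^o})
  (hH : is_bialgebra Delta eps)
  (A : lmodType K) (mu : {linear A ⊗ A -> A}) (hA : associative_mul mu)
  (rho : {linear A -> H ⊗ A}) (hrho : is_comodule_algebra Delta eps mu rho) :
  [/\ forall R : series A (H ⊗ A), is_deformation Delta mu rho R ->
        is_cocycle (dca Delta mu rho) 1 (infinitesimal R),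
      forall R R' : series A (H ⊗ A),
        is_deformation Delta mu rho R -> is_deformation Delta mu rho R' ->
        equivalent mu R R' ->
        cohomologous (dca Delta mu rho) 1
          (infinitesimal R) (infinitesimal R'),
      cohomology_trivial (dh mu) 2 ->
        cohomology_trivial (dca Delta mu rho) 1 ->
        rigid Delta mu rho &
      cohomology_trivial (dca Delta mu rho) 2 ->
        forall f : Fca H mu 1, is_cocycle (dca Delta mu rho) 1 f ->
        exists R : series A (H ⊗ A),
          is_deformation Delta mu rho R /\ infinitesimal R = f].
Proof.
split.
- exact: infinitesimal_cocycle.
- exact: equivalent_cohomologous.
- exact: rigidity hA hrho.
- exact: cocycle_integrable hH hA hrho.
Qed.
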